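(* There are absolute constants $C>1$, $c_1>0$, $c_2>0$ such that the following holds. Let $f=f_n:\{-1,1\}^n\to\{0,1\}$ be a family of monotone Boolean functions indexed by $n$ such that \[ \log\frac{1}{\mathrm{MaxInf}(f)}\ge C\log\frac{1}{\mathrm{Var}[f]}. \] Let $r=\frac{\log \mathrm{Var}[f]}{\log\mathrm{MaxInf}(f)}$, let $\rho\in(0,1]$ satisfy $\rho\ge c_1\sqrt{r\log(1/r)}$, and let $\mathcal{R}$ be a random restriction that keeps exactly $\lceil\rho n\rceil$ variables alive. Then for all sufficiently large $n$, \[ \Pr\left[\mathrm{DT}(f|_{\mathcal{R}})\ge\mathrm{MaxInf}(f)^{-c_2\rho}\right]\ge\frac12. \]
   Context: $f$ is monotone: $f(x)\le f(y)$ whenever $x_i\le y_i$ for all $i$. With Fourier expansion $f=\sum_S\hat f(S)\prod_{j\in S}x_j$, $\mathrm{Inf}_i(f)=\sum_{S\ni i}\hat f(S)^2$, $\mathrm{MaxInf}(f)=\max_i\mathrm{Inf}_i(f)$, and $\mathrm{Var}[f]$ is the variance under the uniform distribution. A random restriction keeping exactly $k$ variables alive chooses a uniformly random set $A\subseteq[n]$ of size $k$ and fixes each coordinate outside $A$ to an independent uniform value in $\{-1,1\}$; $f|_{\mathcal{R}}$ is the restricted function on $\{-1,1\}^A$. $\mathrm{DT}(g)$ is the deterministic decision tree complexity of $g$ (minimum depth of a decision tree querying coordinates that computes $g$). $\log$ is base $2$. *)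

(* Defs.v *)
From mathcomp Require Import all_boot all_order all_algebra.
From mathcomp Require Import boolp reals exp.

Set Implicit Arguments.
Unset Strict Implicit.
Unset Printing Implicit Defensive.

Import Order.TTheory GRing.Theory Num.Theory.
Local Open Scope ring_scope.

(* The cube {-1,1}^T: [true] stands for the coordinate value 1 and [false]
   for -1 (see [sgn]), so the order of {-1,1} is that of [bool]. *)
Notation cube T := {ffun T -> bool}.

Definition sgn (R : realType) (b : bool) : R := if b then 1 else -1.

Definition monotone (T : finType) (f : cube T -> bool) : Prop :=
  forall x y : cube T, (forall i, x i <= y i)%N -> (f x <= f y)%N.

Definition mean (R : realType) (T : finType) (g : cube T -> R) : R :=
  (\sum_(x : cube T) g x) / #|{: cube T}|%:R.

Definition Var (R : realType) (T : finType) (f : cube T -> bool) : R :=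
  mean (fun x => ((f x)%:R - mean (fun y => (f y)%:R)) ^+ 2).

Definition chi (R : realType) (T : finType) (S : {set T}) (x : cube T) : R :=
  \prod_(j in S) sgn R (x j).

Definition fourier (R : realType) (T : finType) (f : cube T -> bool)
    (S : {set T}) : R :=
  mean (fun x => (f x)%:R * chi R S x).

Definition Inf (R : realType) (T : finType) (f : cube T -> bool) (i : T) : R :=
  \sum_(S : {set T} | i \in S) fourier R f S ^+ 2.

Definition MaxInf (R : realType) (T : finType) (f : cube T -> bool) : R :=
  \big[Num.max/0]_(i : T) Inf R f i.

Definition log2 (R : realType) (x : R) : R := ln x / ln 2.

Inductive dtree (T : Type) : Type :=
| Leaf of bool
| Query of T & dtree T & dtree T.

Arguments Leaf {T}.

Fixpoint dt_eval (T : finType) (t : dtree T) (x : cube T) : bool :=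
  match t with
  | Leaf b => b
  | Query i t0 t1 => if x i then dt_eval t1 x else dt_eval t0 x
  end.

Fixpoint depth (T : Type) (t : dtree T) : nat :=
  match t with
  | Leaf _ => 0%N
  | Query _ t0 t1 => (maxn (depth t0) (depth t1)).+1
  end.

Definition has_dtree (T : finType) (g : cube T -> bool) (d : nat) : Prop :=
  exists t : dtree T, dt_eval t =1 g /\ depth t = d.

Lemma has_dtree_ex (T : finType) (g : cube T -> bool) :
  exists d, `[< has_dtree g d >].
Proof.
suff H (s : seq T) (p : cube T) : exists t : dtree T, forall x : cube T,
    dt_eval t x = g [ffun i => if i \in s then x i else p i].
  have [t Ht] := H (enum T) [ffun=> false].
  exists (depth t); apply/asboolP; exists t; split=> // x; rewrite Ht.
  by congr g; apply/ffunP => i; rewrite ffunE mem_enum.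
elim: s p => [|j s IHs] p.
  exists (Leaf (g p)) => x /=; congr g.
  by apply/ffunP => i; rewrite ffunE.
have [t0 H0] := IHs [ffun i => if i == j then false else p i].
have [t1 H1] := IHs [ffun i => if i == j then true else p i].
exists (Query j t0 t1) => x /=.
case E: (x j); rewrite ?H0 ?H1; congr g; apply/ffunP => i;
  by rewrite !ffunE inE; case: eqP => [->|_] //=; rewrite E if_same.
Qed.

Definition DT (T : finType) (g : cube T -> bool) : nat :=
  ex_minn (has_dtree_ex g).

(* The function on {-1,1}^A obtained from [f] by fixing each coordinate i
   outside A to [z i]; the values of [z] on A are not used. *)
Definition restrict (T : finType) (f : cube T -> bool) (A : {set T})
    (z : cube T) (y : cube {i : T | i \in A}) : bool :=
  f [ffun i => if insub i is Some a then y a else z i].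

Arguments restrict {T} f A z y.

(* With (A, z) uniform over these pairs, A is a uniform k-subset and the
   coordinates of z outside A are independent uniform signs given A. *)
Definition restrictions (T : finType) (k : nat) : {set {set T} * cube T} :=
  [set Az : {set T} * cube T | #|Az.1| == k].

Definition prob (R : realType) (U : finType) (Omega : {set U}) (E : pred U) : R :=
  #|[set u in Omega | E u]|%:R / #|Omega|%:R.

(* [fourier] gives the coefficients of the multilinear expansion of f. *)
Lemma fourier_expansion (R : realType) (T : finType) (f : cube T -> bool)
    (x : cube T) :
  (f x)%:R = \sum_(S : {set T}) fourier R f S * \prod_(j in S) sgn R (x j).
Proof.
have E (y : cube T) : \sum_(S : {set T}) chi R S y * chi R S x =
    if y == x then #|{: cube T}|%:R else 0.
  have -> : \sum_(S : {set T}) chi R S y * chi R S x =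
      \prod_(i : T) (sgn R (y i) * sgn R (x i) + 1).
    rewrite bigA_distr; apply: eq_bigr => S _.
    by rewrite -big_split /= -big_mkcond.
  case: eqP => [->|/eqP nyx].
    rewrite card_ffun card_bool natrX -prodr_const; apply: eq_bigr => i _.
    by rewrite /sgn; case: (x i); rewrite ?mulrNN mulr1.
  have [i ne] : exists i, y i != x i.
    by apply/existsP; apply: contraNT nyx => /existsPn H;
       apply/eqP/ffunP => i; apply/eqP; rewrite -[_ == _]negbK H.
  rewrite (bigD1 i) //= /sgn.
  by case: (y i) (x i) ne => [] [] // _; rewrite ?mul1r ?mulr1 addNr mul0r.
have c0 : #|{: cube T}|%:R != 0 :> R.
  by rewrite pnatr_eq0 card_ffun card_bool expn_eq0.
transitivity ((\sum_(y : cube T) (f y)%:R *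
    \sum_(S : {set T}) chi R S y * chi R S x) / #|{: cube T}|%:R).
  under eq_bigr do rewrite E.
  rewrite (bigD1 x) //= eqxx big1 ?addr0 ?mulfK // => y /negPf ->.
  by rewrite mulr0.
under eq_bigr do rewrite mulr_sumr.
rewrite exchange_big /= mulr_suml; apply: eq_bigr => S _.
rewrite /fourier /mean -/(chi R S x) mulrAC; congr (_ / _).
by rewrite mulr_suml; apply: eq_bigr => y _; rewrite mulrA.
Qed.

(* Main.v *)
Require Import Defs.
From mathcomp Require Import all_boot all_order all_algebra.
From mathcomp Require Import boolp reals sequences exp.
From mathcomp Require Import polyrcf.
From mathcomp Require Import ring lra.

(** A function computed by a decision tree of depth [d] has an influence at
    least [4 Var / d], under every product measure.  So a restriction [f|R] has
    large depth as soon as, for some bias [q] of the live coordinates, it has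
    variance bounded below and only small [q]-influences.

    Hypercontractivity bounds the influences of [f|R] by a power
    [1 + c rho] of those of [f] under the biased measure [mu_p], where [p]
    runs through an interval of length [rho / 2] around [1/2]; and by Russo's
    formula and the KKL inequality the mean of [f] under [mu_p] climbs from
    near 0 to near 1 in that interval.  Both need small influences under
    [mu_p], whereas the hypothesis only controls [p = 1/2].  The
    coordinates that are influential at some [p] of a finite grid are therefore
    fixed one after the other, adaptively, to uniform values.  Each step lowers
    a potential built from the means at the grid points, so few steps are
    needed; and a decision tree with few queries is nearly uncorrelated with
    [f] at [p = 1/2], so that the mean of [f] stays away from 0 and 1 at most
    leaves.  Small influences at the grid points suffice, because an influence
    moves at most four times as fast as the mean.

    Since decision tree depth decreases under restriction, the set of exactly
    [k] live coordinates can be replaced by a random set containing each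
    coordinate independently with probability [k / (2 n)]. *)

Set Implicit Arguments.
Unset Strict Implicit.
Unset Printing Implicit Defensive.

Import Order.TTheory GRing.Theory Num.Theory.
Local Open Scope ring_scope.

(** * Product measures on the cube *)

Section Cube.
Variable T : finType.

Definition upd (x : cube T) (i : T) (b : bool) : cube T :=
  [ffun j => if j == i then b else x j].

(** The subfunction stays on the whole cube and ignores coordinate [i], so inductions over
    coordinates never change [T]. *)
Definition sub (A : Type) (h : cube T -> A) (i : T) (b : bool) : cube T -> A :=
  fun x => h (upd x i b).

Lemma upd_id (x : cube T) i : upd x i (x i) = x.
Proof. by apply/ffunP => j; rewrite ffunE; case: eqP => // ->. Qed.

Lemma upd_eq (x : cube T) i b : upd x i b i = b.
Proof. by rewrite ffunE eqxx. Qed.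

Lemma upd_upd (x : cube T) i b c : upd (upd x i b) i c = upd x i c.
Proof. by apply/ffunP => j; rewrite !ffunE; case: eqP. Qed.

Lemma sub_sub (A : Type) (h : cube T -> A) i b c :
  sub (sub h i b) i c = sub h i b.
Proof. by apply/funext => x; rewrite /sub upd_upd. Qed.

(** Induction on the number of coordinates that [h] may depend on: both subfunctions ignore [i]. *)
Lemma cube_ind (A : Type) (P : (cube T -> A) -> Prop) :
    (forall c, P (fun=> c)) ->
    (forall i h, P (sub h i true) -> P (sub h i false) -> P h) ->
  forall h, P h.
Proof.
move=> P0 Pi h.
have: forall x y : cube T, (forall i, i \in enum T -> x i = y i) -> h x = h y.
  by move=> x y xy; congr h; apply/ffunP => i; rewrite xy ?mem_enum.
elim: (enum T) h => [|i s IHs] h hs.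
  suff -> : h = fun=> h [ffun=> false] by [].
  by apply/funext => x; apply: hs.
apply: (Pi i); apply: IHs => x y xy; apply: hs => j; rewrite inE !ffunE;
  by case: eqP => //= _; apply: xy.
Qed.

End Cube.

Section Expectation.
Variables (R : realType) (T : finType).
Implicit Types (p : T -> R) (h k : cube T -> R).

Definition bw (p : R) (b : bool) : R := if b then p else 1 - p.

(** The coordinates are independent, [p i] being the probability of [true]. The values of [p] may be
    any reals, which lets [Ex_poly] treat the mean as a polynomial in the bias; positivity comes
    from [bias]. *)
Definition Ex p h : R := \sum_(x : cube T) (\prod_i bw (p i) (x i)) * h x.

Definition bias p := forall i, 0 <= p i <= 1.

Lemma Ex_upd p h i b :
  Ex p (sub h i b) =
  \sum_(x : cube T | x i == b) (\prod_(j | j != i) bw (p j) (x j)) * h x.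
Proof.
rewrite /Ex (bigID (fun x : cube T => x i == b)) /=.
rewrite [X in _ + X](reindex_onto (fun x : cube T => upd x i (~~ b))
  (fun x => upd x i b)) /=; last first.
  move=> x xi; rewrite upd_upd; have -> : ~~ b = x i by case: (x i) b xi => [] [].
  by rewrite upd_id.
under [X in _ + X]eq_bigl => x.
  rewrite upd_eq upd_upd; have -> : ~~ (~~ b == b) by case: b.
  have -> : (upd x i b == x) = (x i == b).
    apply/eqP/eqP => [<-|<-]; [exact: upd_eq|exact: upd_id].
  over.
rewrite -big_split /=; apply: eq_bigr => x /eqP xi.
rewrite (bigD1 i) //= [in X in _ + X](bigD1 i) //= upd_eq /sub.
rewrite [upd (upd _ _ _) _ _]upd_upd -xi upd_id.
have -> : \prod_(j | j != i) bw (p j) (upd x i (~~ x i) j)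
   = \prod_(j | j != i) bw (p j) (x j).
  by apply: eq_bigr => j /negPf ji; rewrite ffunE ji.
by rewrite -!mulrDl; case: (x i); rewrite /bw /=; congr (_ * _); ring.
Qed.

Lemma Ex_split i p h :
  Ex p h = p i * Ex p (sub h i true) + (1 - p i) * Ex p (sub h i false).
Proof.
rewrite !Ex_upd {1}/Ex (bigID (fun x : cube T => x i == true)) /=.
rewrite !mulr_sumr; congr (_ + _).
  apply: eq_bigr => x /eqP xi.
  by rewrite (bigD1 i) //= xi mulrA.
apply: eq_big => [x|x]; first by case: (x i).
rewrite (bigD1 i) //=; case: (x i) => //= _.
by rewrite mulrA.
Qed.

Lemma eq_Ex p h k : h =1 k -> Ex p h = Ex p k.
Proof. by move=> hk; apply: eq_bigr => x _; rewrite hk. Qed.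

Lemma Ex_cst p c : Ex p (fun=> c) = c.
Proof.
rewrite /Ex -mulr_suml -(bigA_distr_bigA (fun i => bw (p i))) big1 ?mul1r //.
by move=> i _; rewrite big_bool /bw /=; ring.
Qed.

Lemma ExD p h k : Ex p (fun x => h x + k x) = Ex p h + Ex p k.
Proof. by rewrite -big_split; apply: eq_bigr => x _; rewrite mulrDr. Qed.

Lemma ExZ p c h : Ex p (fun x => c * h x) = c * Ex p h.
Proof. by rewrite mulr_sumr; apply: eq_bigr => x _; rewrite mulrCA. Qed.

Lemma ExB p h k : Ex p (fun x => h x - k x) = Ex p h - Ex p k.
Proof.
rewrite -mulN1r -ExZ -ExD; apply: eq_Ex => x; by rewrite mulN1r.
Qed.

Lemma Ex_sum (I : Type) (s : seq I) (P : pred I) p (h : I -> cube T -> R) :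
  Ex p (fun x => \sum_(i <- s | P i) h i x) = \sum_(i <- s | P i) Ex p (h i).
Proof.
rewrite exchange_big /=; apply: eq_bigr => x _; by rewrite mulr_sumr.
Qed.

Lemma Ex_indep i p p' h :
    (forall b, sub h i b = h) -> (forall j, j != i -> p j = p' j) ->
  Ex p h = Ex p' h.
Proof.
move=> hi pp; rewrite -(hi true) !Ex_upd; apply: eq_bigr => x _.
by congr (_ * _); apply: eq_bigr => j ji; rewrite pp.
Qed.

Lemma Ex_le p h k : bias p -> (forall x, h x <= k x) -> Ex p h <= Ex p k.
Proof.
move=> p01 hk; apply: ler_sum => x _; apply: ler_wpM2l => //.
apply: prodr_ge0 => i _; have /andP[p0 p1] := p01 i.
by rewrite /bw; case: (x i) => //; rewrite subr_ge0.
Qed.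

Lemma Ex_ge0 p h : bias p -> (forall x, 0 <= h x) -> 0 <= Ex p h.
Proof. by move=> p01 h0; rewrite -(Ex_cst p 0); apply: Ex_le. Qed.

Lemma Ex_le1 p h : bias p -> (forall x, h x <= 1) -> Ex p h <= 1.
Proof. by move=> p01 h0; rewrite -[leRHS](Ex_cst p 1); apply: Ex_le. Qed.

Lemma Ex_norm p h : bias p -> `|Ex p h| <= Ex p (fun x => `|h x|).
Proof.
move=> p01; rewrite ler_norml; apply/andP; split.
  rewrite lerNl -mulN1r -ExZ; apply: Ex_le => // x; rewrite mulN1r -normrN; exact: ler_norm.
by apply: Ex_le => // x; exact: ler_norm.
Qed.

End Expectation.

(** * A two-point inequality *)

Section TwoPoint.
Variable R : realType.

(** Concavity of the logarithm between [x] and 1, through its tangent at the weighted mean [S]: in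
    the combination with weights [c] and [1 - c] the linear terms cancel ([h3]). *)
Lemma powR_bernoulli (c x : R) : 0 <= c <= 1 -> 0 <= x ->
  x `^ c <= 1 + c * (x - 1).
Proof.
move=> /andP[c0 c1]; rewrite le_eqVlt => /orP[/eqP <-|x0].
  have -> : 0 `^ c = (c == 0)%:R :> R by rewrite /powR eqxx.
  by case: eqP => [->|_] /=; lra.
have S0 : 0 < 1 + c * (x - 1) by nra.
set S := 1 + c * (x - 1) in S0 *.
have lnS (y : R) : 0 < y -> ln (y / S) <= y / S - 1.
  move=> y0; have -> : y / S = 1 + (y / S - 1) by ring.
  rewrite [X in _ <= X - 1]addrC addrK; apply: le_ln1Dx.
  by have := divr_gt0 y0 S0; lra.
have h1 := lnS _ x0; have h2 := lnS 1 ltr01.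
rewrite ln_div ?posrE // in h1; rewrite ln_div ?posrE // ln1 sub0r in h2.
have h3 : c * (x / S - 1) + (1 - c) * (1 / S - 1) = 0.
  by rewrite /S; field; rewrite -/S; lra.
have : c * ln x <= ln S by nra.
by rewrite -ler_expR lnK ?posrE // /powR gt_eqF.
Qed.

(** With [t = B / A], the difference is [A^g (1 - t^g)], at least [A^g (1 - t) / 2] by Bernoulli,
    while [A = A^g A^(1-g) <= 5/2 A^g], again by Bernoulli as [A <= 4]. *)
Lemma powR_dist (g A B : R) : 1 / 2 <= g <= 1 -> 0 <= B -> B <= A -> A <= 4 ->
  (A - B) / 5 <= A `^ g - B `^ g.
Proof.
move=> /andP[g0 g1] B0 BA A4.
have [A0|A0] := eqVneq A 0.
  have -> : B = A by lra.
  by rewrite subrr mul0r subrr.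
have Ap : 0 < A by rewrite lt_neqAle eq_sym A0; lra.
have t0 : 0 <= B / A by rewrite divr_ge0 ?(ltW Ap).
have BE : B = A * (B / A) by field.
have h1 : (B / A) `^ g <= 1 + g * (B / A - 1).
  by apply: powR_bernoulli => //; apply/andP; split; lra.
have h2 : A `^ (1 - g) <= 1 + (1 - g) * (A - 1).
  by apply: powR_bernoulli; first (apply/andP; split); lra.
have h3 : A = A `^ g * A `^ (1 - g).
  by rewrite -powRD ?A0 ?implybT // addrC subrK powRr1 // ltW.
have h4 := powR_ge0 A g; have h5 := powR_ge0 A (1 - g).
have h6 : A <= A `^ g * (5 / 2) by rewrite {1}h3; apply: ler_wpM2l => //; nra.
have t1 : B / A <= 1 by rewrite ler_pdivrMr // mul1r.
have -> : B `^ g = A `^ g * (B / A) `^ g by rewrite {1}BE powRM // ltW.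
have -> : A - B = A * (1 - B / A) by field.
set t := B / A in t0 t1 h1 *.
have h7 : A `^ g * t `^ g <= A `^ g * (1 + g * (t - 1)) by exact: ler_wpM2l.
have h8 : A * (1 - t) <= A `^ g * (5 / 2) * (1 - t) by apply: ler_wpM2r => //; lra.
have h9 : 0 <= A `^ g * (1 - t) * (g - 1 / 2) by rewrite !mulr_ge0 //; lra.
lra.
Qed.

(** By Bernoulli the first two terms are at most [1 + c p (1 - p) (A - B)^2], and [powR_dist] makes
    the subtracted one at least [8/25 c (A - B)^2]. Since [p (1 - p) <= 1/4 < 8/25], the excess is
    absorbed. *)
Lemma two_point_normalized (c k p A B : R) :
    0 <= c <= 1 -> 1 / 4 <= p <= 3 / 4 -> 8 * c <= k -> 0 <= A -> 0 <= B ->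
    p * A + (1 - p) * B = 1 ->
  p * A `^ ((1 + c) / 2) ^+ 2 + (1 - p) * B `^ ((1 + c) / 2) ^+ 2
    - k * (A `^ ((1 + c) / 2) - B `^ ((1 + c) / 2)) ^+ 2 <= 1.
Proof.
move=> /andP[c0 c1] /andP[p0 p1] ck A0 B0 m1.
have sq (x : R) : 0 <= x -> x `^ ((1 + c) / 2) ^+ 2 <= x * (1 + c * (x - 1)).
  move=> x0; rewrite expr2 -powRD; last by apply/implyP => /eqP; lra.
  have -> : (1 + c) / 2 + (1 + c) / 2 = 1 + c by field.
  rewrite powRD ?powRr1 //; last by apply/implyP => /eqP; lra.
  by apply: ler_wpM2l => //; apply: powR_bernoulli => //; rewrite c0.
have A4 : A <= 4 by nra.
have B4 : B <= 4 by nra.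
have dist : ((A - B) / 5) ^+ 2 <= (A `^ ((1 + c) / 2) - B `^ ((1 + c) / 2)) ^+ 2.
  have g : 1 / 2 <= (1 + c) / 2 <= 1 by apply/andP; split; lra.
  have [BA|AB] := leP B A.
    by rewrite lerXn2r ?nnegrE ?powR_dist //; have := powR_dist g B0 BA A4; lra.
  have /= h := powR_dist g A0 (ltW AB) B4.
  rewrite -sqrrN -[leRHS]sqrrN lerXn2r ?nnegrE //; lra.
have hA := sq _ A0; have hB := sq _ B0.
have v : p * A ^+ 2 + (1 - p) * B ^+ 2 - 1 = p * (1 - p) * (A - B) ^+ 2.
  transitivity (p * A ^+ 2 + (1 - p) * B ^+ 2 - (p * A + (1 - p) * B) ^+ 2).
    by rewrite m1 expr1n.
  by ring.
set X := A `^ _ in hA dist *; set Y := B `^ _ in hB dist *.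
have D0 := sqr_ge0 (A - B).
have h1 : k * ((A - B) / 5) ^+ 2 <= k * (X - Y) ^+ 2 by apply: ler_wpM2l => //; lra.
have h2 : p * X ^+ 2 <= p * (A * (1 + c * (A - 1))) by apply: ler_wpM2l => //; lra.
have h3 : (1 - p) * Y ^+ 2 <= (1 - p) * (B * (1 + c * (B - 1))).
  by apply: ler_wpM2l => //; lra.
have h4 : p * (A * (1 + c * (A - 1))) + (1 - p) * (B * (1 + c * (B - 1))) =
   1 + c * (p * (1 - p) * (A - B) ^+ 2).
  by rewrite -v; transitivity ((p * A + (1 - p) * B) * (1 - c)
     + c * (p * A ^+ 2 + (1 - p) * B ^+ 2)); [ring|rewrite m1; ring].
have h5 : 8 * c * (A - B) ^+ 2 <= k * (A - B) ^+ 2 by apply: ler_wpM2r.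
have h6 : c * (p * (1 - p) * (A - B) ^+ 2) <= c * (1 / 4 * (A - B) ^+ 2).
  by apply: ler_wpM2l => //; apply: ler_wpM2r => //; have := sqr_ge0 (p - 1 / 2); lra.
have h7 : 0 <= c * (A - B) ^+ 2 by rewrite mulr_ge0.
have : k * ((A - B) / 5) ^+ 2 = k * (A - B) ^+ 2 / 25 by field.
lra.
Qed.

(** Both sides are homogeneous of degree [1 + c] in [A] and [B]; dividing by the mean [m] reduces to
    [two_point_normalized]. *)
Lemma two_point (c k p A B : R) :
    0 <= c <= 1 -> 1 / 4 <= p <= 3 / 4 -> 8 * c <= k -> 0 <= A -> 0 <= B ->
  p * A `^ ((1 + c) / 2) ^+ 2 + (1 - p) * B `^ ((1 + c) / 2) ^+ 2
    - k * (A `^ ((1 + c) / 2) - B `^ ((1 + c) / 2)) ^+ 2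
  <= (p * A + (1 - p) * B) `^ (1 + c).
Proof.
move=> c01 p01 ck A0 B0.
have g0 : (1 + c) / 2 != 0 by apply/eqP; lra.
set m := p * A + (1 - p) * B.
have [m0|m0] := eqVneq m 0.
  have [-> ->] : A = 0 /\ B = 0 by rewrite /m in m0; split; nra.
  by rewrite powR0 // !expr2 !mulr0 subrr !mulr0 addr0 subr0 powR_ge0.
have mp : 0 < m by rewrite lt_neqAle eq_sym m0 /m; nra.
have E (x : R) : 0 <= x -> x `^ ((1 + c) / 2) =
    m `^ ((1 + c) / 2) * (x / m) `^ ((1 + c) / 2).
  move=> x0; rewrite -powRM ?divr_ge0 ?(ltW mp) //; congr (_ `^ _); field; exact: m0.
have mE : m `^ (1 + c) = m `^ ((1 + c) / 2) ^+ 2.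
  by rewrite expr2 -powRD ?m0 ?implybT //; congr (_ `^ _); field.
have := @two_point_normalized c k p (A / m) (B / m) c01 p01 ck.
rewrite !divr_ge0 ?(ltW mp) // => /(_ isT isT).
have -> : p * (A / m) + (1 - p) * (B / m) = 1 by rewrite /m; field; rewrite -/m.
move=> /(_ erefl); rewrite (E A) // (E B) // mE.
set M := m `^ _; set X := _ `^ _; set Y := _ `^ _ => h.
have := ler_wpM2l (sqr_ge0 M) h; rewrite mulr1; apply: le_trans.
rewrite le_eqVlt; apply/orP; left; apply/eqP; ring.
Qed.

End TwoPoint.

(** * Random restrictions and hypercontractivity *)

Section Restriction.
Variables (R : realType) (T : finType).
Implicit Types (p a s q : T -> R) (h k : cube T -> R).

Definition mix (B y z : cube T) : cube T := [ffun i => if B i then y i else z i].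

Lemma mix_true (B y z : cube T) i b :
  mix (upd B i true) (upd y i b) z = upd (mix B y z) i b.
Proof. by apply/ffunP => j; rewrite !ffunE; case: eqP. Qed.

Lemma mix_false (B y z : cube T) i b :
  mix (upd B i false) y (upd z i b) = upd (mix B y z) i b.
Proof. by apply/ffunP => j; rewrite !ffunE; case: eqP. Qed.

(** [B] marks the random live set, [i] being live with probability [a i], and [z] supplies, under
    the bias [s], the values used outside it. *)
Definition ER a s (F : cube T -> cube T -> R) : R :=
  Ex a (fun B => Ex s (fun z => F B z)).

Lemma eq_ER a s (F G : cube T -> cube T -> R) :
  (forall B z, F B z = G B z) -> ER a s F = ER a s G.
Proof. by move=> FG; apply: eq_Ex => B; apply: eq_Ex. Qed.

Lemma ERD a s (F G : cube T -> cube T -> R) :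
  ER a s (fun B z => F B z + G B z) = ER a s F + ER a s G.
Proof. by rewrite /ER -ExD; apply: eq_Ex => B; rewrite ExD. Qed.

Lemma ERZ a s c (F : cube T -> cube T -> R) :
  ER a s (fun B z => c * F B z) = c * ER a s F.
Proof. by rewrite /ER -ExZ; apply: eq_Ex => B; rewrite ExZ. Qed.

Lemma ERB a s (F G : cube T -> cube T -> R) :
  ER a s (fun B z => F B z - G B z) = ER a s F - ER a s G.
Proof. by rewrite /ER -ExB; apply: eq_Ex => B; rewrite ExB. Qed.

Lemma ER_sum (I : Type) (r : seq I) a s (F : I -> cube T -> cube T -> R) :
  ER a s (fun B z => \sum_(i <- r) F i B z) = \sum_(i <- r) ER a s (F i).
Proof. by rewrite /ER -Ex_sum; apply: eq_Ex => B; rewrite Ex_sum. Qed.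

Lemma ER_cst a s c : ER a s (fun _ _ => c) = c.
Proof. by rewrite /ER; under eq_Ex do rewrite Ex_cst; rewrite Ex_cst. Qed.

Lemma ER_le a s (F G : cube T -> cube T -> R) : bias a -> bias s ->
  (forall B z, F B z <= G B z) -> ER a s F <= ER a s G.
Proof. by move=> ha hs FG; apply: Ex_le => // B; apply: Ex_le. Qed.

Lemma ER_ge0 a s (F : cube T -> cube T -> R) : bias a -> bias s ->
  (forall B z, 0 <= F B z) -> 0 <= ER a s F.
Proof. by move=> ha hs F0; rewrite -(ER_cst a s 0); apply: ER_le. Qed.

Lemma ER_split i a s (F : cube T -> cube T -> R) :
  ER a s F = a i * ER a s (fun B z => F (upd B i true) z) +
    (1 - a i) * (s i * ER a s (fun B z => F (upd B i false) (upd z i true)) +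
      (1 - s i) * ER a s (fun B z => F (upd B i false) (upd z i false))).
Proof.
rewrite {1}/ER (Ex_split i); congr (_ * _ + _ * _).
by rewrite -!ExZ -ExD; apply: eq_Ex => B; rewrite /sub (Ex_split i).
Qed.

(** The expectation of [(t G + F)^2] is a nonnegative polynomial of degree at most 2 in [t], so its
    discriminant is nonpositive. *)
Lemma ER_cauchy_schwarz a s (F G : cube T -> cube T -> R) : bias a -> bias s ->
  ER a s (fun B z => F B z * G B z) ^+ 2 <=
  ER a s (fun B z => F B z ^+ 2) * ER a s (fun B z => G B z ^+ 2).
Proof.
move=> ha hs; set u := ER a s (fun B z => G B z ^+ 2).
set v := ER a s (fun B z => F B z * G B z).
set w := ER a s (fun B z => F B z ^+ 2).
pose P : {poly R} := u *: 'X^2 + (2 * v) *: 'X + w%:P.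
have [P2 P1 P0] : [/\ P`_2 = u, P`_1 = 2 * v & P`_0 = w].
  by rewrite /P !coefD !coefZ !coefXn !coefX !coefC /=; split; ring.
have Psz : (size P <= 3)%N.
  by apply/leq_sizeP => j; case: j => [|[|[|j]]] // _;
    rewrite /P !coefD !coefZ !coefXn !coefX !coefC /=; ring.
have : P`_1 ^+ 2 - 4 * P`_2 * P`_0 <= 0.
  apply: deg_le2_poly_ge0 => // t.
  suff -> : P.[t] = ER a s (fun B z => (t * G B z + F B z) ^+ 2).
    by apply: ER_ge0 => // B z; exact: sqr_ge0.
  transitivity (t ^+ 2 * u + (2 * t) * v + w).
    by rewrite /P !(hornerD, hornerZ, hornerXn, hornerX, hornerC); ring.
  by rewrite -!ERZ -!ERD; apply: eq_ER => B z; ring.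
by rewrite P2 P1 P0; nra.
Qed.

(** The mean of the restricted function when its live coordinates get the bias [q]. *)
Definition Rm q h (B z : cube T) : R := Ex q (fun y => h (mix B y z)).

Lemma Rm_true q h (B z : cube T) i : Rm q h (upd B i true) z =
  q i * Rm q (sub h i true) B z + (1 - q i) * Rm q (sub h i false) B z.
Proof.
by rewrite /Rm (Ex_split i); congr (_ * _ + _ * _); apply: eq_Ex => y;
  rewrite /sub mix_true.
Qed.

Lemma Rm_false q h (B z : cube T) i b :
  Rm q h (upd B i false) (upd z i b) = Rm q (sub h i b) B z.
Proof. by apply: eq_Ex => y; rewrite mix_false. Qed.

(** The bias of a coordinate of [mix B y z]: it is [s i] when dead and [q i] when live. *)
Definition pm a s q (i : T) : R := (1 - a i) * s i + a i * q i.

Lemma ER_Rm a s q h : ER a s (Rm q h) = Ex (pm a s q) h.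
Proof.
elim/cube_ind: h => [c|i h IH1 IH0].
  by rewrite Ex_cst -[RHS](ER_cst a s c); apply: eq_ER => B z; rewrite /Rm Ex_cst.
rewrite (ER_split i) (Ex_split i) -IH1 -IH0.
rewrite (eq_ER _ _ (fun B z => Rm_true q h B z i)) ERD !ERZ.
rewrite !(eq_ER _ _ (fun B z => Rm_false q h B z i _)).
by rewrite /pm; ring.
Qed.

(** A noise stability: for [s = q] it is the expectation of [h x * h x'], where [x'] is [x] with its
    live coordinates redrawn. *)
Definition Q a s q h : R := ER a s (fun B z => Rm q h B z ^+ 2).

(** A dead [i] averages the two subfunctions; a live one gives the square of [q H1 + (1 - q) H0],
    which is [q H1^2 + (1 - q) H0^2 - q (1 - q) (H1 - H0)^2]. *)
Lemma Q_split i a s q h : Q a s q h =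
  pm a s q i * Q a s q (sub h i true) + (1 - pm a s q i) * Q a s q (sub h i false)
  - a i * q i * (1 - q i) * Q a s q (fun x => sub h i true x - sub h i false x).
Proof.
rewrite {1}/Q (ER_split i).
under eq_ER do rewrite Rm_true.
under [X in _ + _ * (_ * X + _)]eq_ER do rewrite Rm_false.
under [X in _ + _ * (_ + _ * X)]eq_ER do rewrite Rm_false.
have -> : ER a s (fun B z => (q i * Rm q (sub h i true) B z +
      (1 - q i) * Rm q (sub h i false) B z) ^+ 2) =
    q i * Q a s q (sub h i true) + (1 - q i) * Q a s q (sub h i false)
   - q i * (1 - q i) * Q a s q (fun x => sub h i true x - sub h i false x).
  rewrite /Q -!ERZ -ERD -ERB; apply: eq_ER => B z.
  have -> : Rm q (fun x => sub h i true x - sub h i false x) B z =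
    Rm q (sub h i true) B z - Rm q (sub h i false) B z by rewrite /Rm ExB.
  by ring.
by rewrite -!/(Q a s q _) /pm; ring.
Qed.

Lemma Q_ge0 a s q h : bias a -> bias s -> 0 <= Q a s q h.
Proof. by move=> ha hs; apply: ER_ge0 => // B z; exact: sqr_ge0. Qed.

Lemma bias_pm a s q : bias a -> bias s -> bias q -> bias (pm a s q).
Proof.
move=> ha hs hq i; have /andP[? ?] := ha i; have /andP[? ?] := hs i.
by have /andP[? ?] := hq i; rewrite /pm; apply/andP; split; nra.
Qed.

(* Conditioning on one coordinate turns both sides into the two sides of
   [two_point]; the cross term is bounded by Cauchy-Schwarz. *)
Lemma hypercontractive (c : R) a s q h :
    bias a -> bias s -> bias q -> 0 <= c <= 1 ->
    (forall i, 1 / 4 <= pm a s q i <= 3 / 4) ->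
    (forall i, 8 * c <= a i * q i * (1 - q i)) ->
    (forall x, 0 <= h x <= 1) ->
  Q a s q h <= Ex (pm a s q) h `^ (1 + c).
Proof.
move=> ha hs hq /andP[c0 c1] hp hc.
have c01 : 0 <= c <= 1 by rewrite c0.
elim/cube_ind: h => [u|i h IH1 IH0] h01.
  rewrite Ex_cst; have -> : Q a s q (fun=> u) = u ^+ 2.
    rewrite -[RHS](ER_cst a s); apply: eq_ER => B z; by rewrite /Rm Ex_cst.
  have {h01} /andP[u0 u1] := h01 [ffun=> false].
  rewrite powRD ?powRr1 //; last by apply/implyP => /eqP; lra.
  rewrite expr2; apply: ler_wpM2l => //.
  have [->|un0] := eqVneq u 0; first exact: powR_ge0.
  by apply: ger1_powR => //; rewrite lt_neqAle eq_sym un0 u0.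
have g1 x : 0 <= sub h i true x <= 1 by exact: h01.
have g0 x : 0 <= sub h i false x <= 1 by exact: h01.
have {IH1} h1 := IH1 g1; have {IH0} h0 := IH0 g0.
have bp := bias_pm ha hs hq.
rewrite (Q_split i) (Ex_split i).
set E1 := Ex _ (sub h i true) in h1 *; set E0 := Ex _ (sub h i false) in h0 *.
set Q1 := Q _ _ _ (sub h i true) in h1 *.
set Q0 := Q _ _ _ (sub h i false) in h0 *.
have E1p : 0 <= E1 by apply: Ex_ge0 => // x; case/andP: (g1 x).
have E0p : 0 <= E0 by apply: Ex_ge0 => // x; case/andP: (g0 x).
pose C := ER a s (fun B z => Rm q (sub h i true) B z * Rm q (sub h i false) B z).
have -> : Q a s q (fun x => sub h i true x - sub h i false x) = Q1 + Q0 - 2 * C.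
  rewrite /Q1 /Q0 /Q /C -ERZ -ERD -ERB; apply: eq_ER => B z.
  have -> : Rm q (fun x => sub h i true x - sub h i false x) B z =
    Rm q (sub h i true) B z - Rm q (sub h i false) B z by rewrite /Rm ExB.
  by ring.
have CS : C ^+ 2 <= Q1 * Q0 by exact: ER_cauchy_schwarz.
have Q1p : 0 <= Q1 by exact: Q_ge0.
have Q0p : 0 <= Q0 by exact: Q_ge0.
have tp := two_point c01 (hp i) (hc i) E1p E0p.
have sq x : x `^ (1 + c) = x `^ ((1 + c) / 2) ^+ 2.
  rewrite expr2 -powRD; first by congr (_ `^ _); field.
  by apply/implyP => /eqP; lra.
have X0 := powR_ge0 E1 ((1 + c) / 2); have Y0 := powR_ge0 E0 ((1 + c) / 2).
rewrite (sq E1) in h1; rewrite (sq E0) in h0; apply: le_trans tp.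
set X := E1 `^ _ in h1 X0 *; set Y := E0 `^ _ in h0 Y0 *.
have CXY : C <= X * Y.
  apply: le_trans (ler_norm _) _.
  rewrite -(ler_pXn2r (n := 2)) ?nnegrE ?mulr_ge0 // real_normK ?num_real //.
  apply: le_trans CS _; rewrite exprMn; exact: ler_pM.
have /andP[a0 a1] := ha i; have /andP[s0 s1] := hs i; have /andP[q0 q1] := hq i.
(* Once the square of the difference is expanded, these are the coefficients of [Q1] and [Q0]; they
   must be nonnegative for the induction hypotheses to apply. *)
have k1 : 0 <= pm a s q i - a i * q i * (1 - q i).
  have -> : pm a s q i - a i * q i * (1 - q i) = (1 - a i) * s i + a i * q i ^+ 2.
    by rewrite /pm; ring.
  by rewrite addr_ge0 ?mulr_ge0 ?sqr_ge0 ?subr_ge0.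
have k0 : 0 <= 1 - pm a s q i - a i * q i * (1 - q i).
  have -> : 1 - pm a s q i - a i * q i * (1 - q i) =
    (1 - a i) * (1 - s i) + a i * (1 - q i) ^+ 2 by rewrite /pm; ring.
  by rewrite addr_ge0 ?mulr_ge0 ?sqr_ge0 ?subr_ge0.
have k2 : 0 <= a i * q i * (1 - q i) by rewrite !mulr_ge0 ?subr_ge0.
set k := a i * q i * (1 - q i) in k0 k1 k2 *; set r := pm a s q i in k0 k1 *.
have m1 := ler_wpM2l k1 h1; have m0 := ler_wpM2l k0 h0; have m2 := ler_wpM2l k2 CXY.
lra.
Qed.

End Restriction.

(** * Influences and Russo's formula *)

Section Influence.
Variables (R : realType) (T : finType).
Implicit Types (p : T -> R) (f : cube T -> bool) (h : cube T -> R).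

Definition M p f : R := Ex p (fun x => (f x)%:R).

Definition N p f i : R := M p (sub f i true) - M p (sub f i false).

Definition diff f i (x : cube T) : R := (sub f i true x)%:R - (sub f i false x)%:R.

Lemma Ex_diff p f i : Ex p (diff f i) = N p f i.
Proof. by rewrite /N /M -ExB. Qed.

Lemma monotone_sub f i b : monotone f -> monotone (sub f i b).
Proof.
by move=> mf x y xy; apply: mf => j; rewrite !ffunE; case: eqP.
Qed.

Lemma diff_bound f i x : monotone f -> 0 <= diff f i x <= 1.
Proof.
move=> mf; rewrite /diff.
have : (sub f i false x <= sub f i true x)%N.
  by apply: mf => j; rewrite !ffunE; case: eqP.
by case: (sub f i true x) (sub f i false x) => [] [] //= _;
  rewrite ?subrr ?subr0 ?lexx ?ler01.
Qed.

Lemma sub_diff f i b : sub (diff f i) i b = diff f i.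
Proof. by apply/funext => x; rewrite /diff /sub !upd_upd. Qed.

Lemma N_ge0 p f i : bias p -> monotone f -> 0 <= N p f i.
Proof.
move=> hp mf; rewrite -Ex_diff; apply: Ex_ge0 => // x.
by case/andP: (diff_bound i x mf).
Qed.

Lemma M_ge0 p f : bias p -> 0 <= M p f.
Proof. by move=> hp; apply: Ex_ge0 => // x; case: (f x). Qed.

Lemma M_le1 p f : bias p -> M p f <= 1.
Proof. by move=> hp; apply: Ex_le1 => // x; case: (f x). Qed.

Lemma M_split i p f :
  M p f = p i * M p (sub f i true) + (1 - p i) * M p (sub f i false).
Proof. exact: Ex_split. Qed.

Lemma upd_comm (x : cube T) i j b c : i != j ->
  upd (upd x i b) j c = upd (upd x j c) i b.
Proof.
move=> ij; apply/ffunP => k; rewrite !ffunE.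
by case: (eqVneq k j) => [->|//]; rewrite eq_sym (negPf ij).
Qed.

(** Russo's formula. The product rule in the expansion along [i] yields the influence of [i] from
    the factors [u] and [1 - u], and the other influences by induction. *)
Lemma Ex_poly h : exists P : {poly R}, forall u,
  P.[u] = Ex (fun=> u) h /\
  P^`().[u] = \sum_i Ex (fun=> u) (fun x => sub h i true x - sub h i false x).
Proof.
elim/cube_ind: h => [c|i h [P1 h1] [P0 h0]].
  exists c%:P => u; rewrite hornerC Ex_cst derivC horner0; split=> //.
  by rewrite big1 // => i _; rewrite ExB subrr.
exists ('X * P1 + (1%:P - 'X) * P0) => u.
have [e1 d1] := h1 u; have [e0 d0] := h0 u; split.
  by rewrite !(hornerD, hornerM, hornerN, hornerX, hornerC) e1 e0 (Ex_split i _ h).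
rewrite derivD !derivM derivB derivX derivC.
rewrite !(hornerD, hornerM, hornerN, hornerX, hornerC) e1 e0 d1 d0.
pose E := @Ex R T (fun=> u).
transitivity (E (sub h i true) - E (sub h i false) + \sum_j
  (u * E (fun x => sub (sub h i true) j true x - sub (sub h i true) j false x) +
  (1 - u) * E (fun x => sub (sub h i false) j true x - sub (sub h i false) j false x))).
  rewrite big_split /= -!mulr_sumr /E; ring.
rewrite (bigD1 i) //= [RHS](bigD1 i) //=.
have -> : E (fun x => sub (sub h i true) i true x - sub (sub h i true) i false x) = 0.
  by rewrite !sub_sub /E ExB subrr.
have -> : E (fun x => sub (sub h i false) i true x - sub (sub h i false) i false x) = 0.
  by rewrite !sub_sub /E ExB subrr.
rewrite !mulr0 addr0 add0r; congr (_ + _); first by rewrite /E -ExB.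
apply: eq_bigr => j ji; rewrite [RHS](Ex_split i) /=; congr (_ * _ + _ * _);
  by apply: eq_Ex => x; rewrite /sub !(upd_comm x _ _ ji).
Qed.

Lemma M_mvt f (u v : R) : u < v -> exists2 w, u < w < v &
  M (fun=> v) f - M (fun=> u) f = (v - u) * \sum_i N (fun=> w) f i.
Proof.
move=> uv; have [P hP] := Ex_poly (fun x => (f x)%:R).
have [w] := poly_mvt P uv; rewrite in_itv /= => uwv e; exists w => //.
have [ev _] := hP v; have [eu _] := hP u; have [_ ew] := hP w.
rewrite ev eu ew mulrC in e; rewrite /M e; congr (_ * _).
by apply: eq_bigr => i _; rewrite -Ex_diff.
Qed.

Lemma M_le f (u v : R) : monotone f -> 0 <= u -> u <= v -> v <= 1 ->
  M (fun=> u) f <= M (fun=> v) f.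
Proof.
move=> mf u0; rewrite le_eqVlt => /orP[/eqP -> //|uv] v1.
have [w /andP[uw wv] e] := M_mvt f uv.
rewrite -subr_ge0 e mulr_ge0 ?subr_ge0 ?(ltW uv) // sumr_ge0 // => i _.
by apply: N_ge0 => // j; rewrite (ltW (le_lt_trans u0 uw)) (ltW (lt_le_trans wv v1)).
Qed.

(** The change in influence is the growth of one subfunction's mean minus that of the other, both
    nonnegative. Each enters the growth of [M f] with weight at least 1/4, and the shift of weight
    towards the larger subfunction only adds to it. *)
Lemma N_lipschitz f i (u v : R) : monotone f -> 1 / 4 <= u -> u <= v -> v <= 3 / 4 ->
  `|N (fun=> v) f i - N (fun=> u) f i| <= 4 * (M (fun=> v) f - M (fun=> u) f).
Proof.
move=> mf u4 uv v4.
have n0 : 0 <= N (fun=> u) f i by apply: N_ge0 => // j; apply/andP; split; lra.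
rewrite (M_split i (fun=> v)) (M_split i (fun=> u)).
have m b : M (fun=> u) (sub f i b) <= M (fun=> v) (sub f i b).
  by apply: M_le; first exact: monotone_sub; lra.
have m1 := m true; have m0 := m false; rewrite /N in n0 *.
set a := M _ (sub f i true) in n0 m1 *; set a' := M _ (sub f i true) in m1 *.
set b := M _ (sub f i false) in n0 m0 *; set b' := M _ (sub f i false) in m0 *.
by rewrite ler_norml; apply/andP; split; nra.
Qed.

End Influence.

(** * The KKL inequality *)

Section KKL.
Variables (R : realType) (T : finType).
Implicit Types (p a s q : T -> R) (f : cube T -> bool) (h : cube T -> R).

Lemma Ex_zero h : Ex (fun=> 0) h = h [ffun=> false].
Proof.
elim/cube_ind: h => [c|i h _ IH]; first by rewrite Ex_cst.
rewrite (Ex_split i) mul0r add0r subr0 mul1r IH /sub; congr h.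
by apply/ffunP => j; rewrite !ffunE if_same.
Qed.

Lemma Ex_one h : Ex (fun=> 1) h = h [ffun=> true].
Proof.
elim/cube_ind: h => [c|i h IH _]; first by rewrite Ex_cst.
rewrite (Ex_split i) subrr mul0r addr0 mul1r IH /sub; congr h.
by apply/ffunP => j; rewrite !ffunE if_same.
Qed.

Lemma Q_zero s q h : Q (fun=> 0) s q h = Ex s (fun x => h x ^+ 2).
Proof.
rewrite /Q /ER Ex_zero; apply: eq_Ex => z; congr (_ ^+ 2).
rewrite -[RHS](Ex_cst q); apply: eq_Ex => y; congr h.
by apply/ffunP => j; rewrite !ffunE.
Qed.

Lemma Q_one s q h : Q (fun=> 1) s q h = Ex q h ^+ 2.
Proof.
rewrite /Q /ER Ex_one -[RHS](Ex_cst s); apply: eq_Ex => z; congr (_ ^+ 2).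
apply: eq_Ex => y; congr h; by apply/ffunP => j; rewrite !ffunE.
Qed.

Lemma Q_indep i a a' s q h : (forall b, sub h i b = h) ->
  (forall j, j != i -> a j = a' j) -> Q a s q h = Q a' s q h.
Proof.
move=> hi aa; apply: (@Ex_indep _ _ i) => // b; apply/funext => B.
apply: eq_Ex => z; congr (_ ^+ 2); apply: eq_Ex => y.
rewrite -(hi true) /sub; congr h; apply/ffunP => j; rewrite !ffunE.
by case: eqP.
Qed.

(** The live probability is raised from [u] to [v] one coordinate at a time. By [Q_split] the step
    at [i] costs [(v - u) r (1 - r)] times the [Q] of [diff f i], which hypercontractivity
    bounds. *)
Lemma Q_hybrid f (u v r : R) : monotone f -> 1 / 4 <= r <= 3 / 4 ->
    0 <= u -> u <= v -> v <= 1 ->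
  Q (fun=> u) (fun=> r) (fun=> r) (fun x => (f x)%:R) -
  Q (fun=> v) (fun=> r) (fun=> r) (fun x => (f x)%:R) <=
  (v - u) / 4 * \sum_i N (fun=> r) f i `^ (1 + u / 64).
Proof.
move=> mf r14 u0 uv v1; have /andP[r0 r1] := r14; set h := fun x => (f x)%:R.
pose a (s : seq T) i := if i \in s then v else u.
have aE : Q (fun=> v) (fun=> r) (fun=> r) h = Q (a (enum T)) (fun=> r) (fun=> r) h.
  by congr (Q _ _ _ _); apply/funext => i; rewrite /a mem_enum.
have ba (l : seq T) : bias (a l) by move=> i; rewrite /a; case: ifP => _; apply/andP; split; lra.
have br : bias (fun=> r : R) (T := T) by move=> i; apply/andP; split; lra.
have pmE (b : T -> R) : pm b (fun=> r) (fun=> r) = fun=> r : R.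
  by apply/funext => i; rewrite /pm; ring.
rewrite aE -big_enum /=; have := enum_uniq T; elim: (enum T) => [|i s IHs].
  by rewrite big_nil mulr0 subr_le0 le_eqVlt => _; apply/orP; left; apply/eqP; congr (Q _ _ _ _);
     apply/funext.
rewrite /= => /andP[si /IHs {}IHs]; rewrite big_cons mulrDr.
have aai j : j != i -> a (i :: s) j = a s j.
  by move=> /negPf ji; rewrite /a inE ji.
have e (b : bool) : Q (a (i :: s)) (fun=> r) (fun=> r) (sub h i b) =
    Q (a s) (fun=> r) (fun=> r) (sub h i b).
  by apply: (@Q_indep i) => // c; rewrite sub_sub.
have := Q_split i (a s) (fun=> r) (fun=> r) h.
have := Q_split i (a (i :: s)) (fun=> r) (fun=> r) h.
have ai : a (i :: s) i = v by rewrite /a mem_head.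
have asi : a s i = u by rewrite /a (negPf si).
rewrite !pmE !e ai asi.
have eD : (fun x => sub h i true x - sub h i false x) = diff R f i by [].
have eQ : Q (a (i :: s)) (fun=> r) (fun=> r) (diff R f i) =
    Q (a s) (fun=> r) (fun=> r) (diff R f i).
  by apply: (@Q_indep i) => // b; exact: sub_diff.
rewrite eD eQ.
(* [hypercontractive] asks for [8 c <= a j r (1 - r)]; here [a j >= u] and [r (1 - r) >= 3/16], so
   [c = u / 64] is admissible. *)
have hy : Q (a s) (fun=> r) (fun=> r) (diff R f i) <= N (fun=> r) f i `^ (1 + u / 64).
  have := @hypercontractive R T (u / 64) (a s) (fun=> r) (fun=> r) (diff R f i).
  rewrite pmE Ex_diff; apply => //.
  - by apply/andP; split; lra.
  - move=> j; have : u <= a s j by rewrite /a; case: ifP.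
    move=> uj; have hr : 3 / 16 <= r * (1 - r) by nra.
    by rewrite -mulrA; apply: le_trans (ler_pM _ _ uj hr); lra.
  - by move=> x; exact: diff_bound.
have D0 : 0 <= Q (a s) (fun=> r) (fun=> r) (diff R f i) by exact: Q_ge0.
set D := Q _ _ _ (diff R f i) in hy D0 *; set w := N _ f i `^ _ in hy *.
have k1 : (v - u) * (r * (1 - r)) * D <= (v - u) / 4 * w.
  apply: ler_pM => //; first by rewrite !mulr_ge0 //; lra.
  by apply: ler_wpM2l; [lra | have := sqr_ge0 (r - 1 / 2); lra].
lra.
Qed.

Lemma sum_half_pow n : \sum_(k < n) (1 / 2 : R) ^+ k <= 2.
Proof.
suff -> : \sum_(k < n) (1 / 2 : R) ^+ k = 2 - 2 * (1 / 2) ^+ n.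
  by have := exprn_ge0 n (_ : 0 <= 1 / 2 :> R); lra.
elim: n => [|n IHn]; first by rewrite big_ord0 expr0; ring.
by rewrite big_ord_recr /= IHn exprS; field.
Qed.

(* The variance is the total drop of [Q] as the live fraction grows from 0 to 1;
   cut into [K] steps, the drop in step [k] is at most [2^-k / (4 K)] times the
   total influence. *)
Lemma kkl f (r : R) (K : nat) : monotone f -> 1 / 4 <= r <= 3 / 4 -> (0 < K)%N ->
    (forall i, N (fun=> r) f i <= (1 / 2) ^+ (64 * K)) ->
  2 * K%:R * (M (fun=> r) f * (1 - M (fun=> r) f)) <= \sum_i N (fun=> r) f i.
Proof.
move=> mf r14 K0 hN; have /andP[r0 r1] := r14.
have br : bias (fun=> r : R) (T := T) by move=> i; apply/andP; split; lra.
have KR : 0 < K%:R :> R by rewrite ltr0n.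
pose h x : R := (f x)%:R; pose q (u : R) := Q (fun=> u) (fun=> r) (fun=> r) h.
(* With no live coordinate [Q] is the second moment, with all of them live the squared mean. *)
have -> : M (fun=> r) f * (1 - M (fun=> r) f) = q 0 - q 1.
  rewrite /q Q_zero Q_one /M mulrBr mulr1 expr2; congr (_ - _).
  by apply: eq_Ex => x; rewrite /h; case: (f x); rewrite ?expr1n ?expr0n.
have tel n : q (0%:R / K%:R) - q (n%:R / K%:R) =
    \sum_(k < n) (q (k%:R / K%:R) - q (k.+1%:R / K%:R)).
  elim: n => [|n IHn]; first by rewrite big_ord0 subrr.
  by rewrite big_ord_recr /= -IHn; ring.
have -> : q 0 - q 1 = \sum_(k < K) (q (k%:R / K%:R) - q (k.+1%:R / K%:R)).
  by rewrite -tel mul0r divff ?gt_eqF.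
set I := \sum_i N (fun=> r) f i.
have I0 : 0 <= I by apply: sumr_ge0 => i _; exact: N_ge0.
have step (k : 'I_K) : q (k%:R / K%:R) - q (k.+1%:R / K%:R) <=
    (1 / K%:R) / 4 * (I * (1 / 2) ^+ k).
  have -> : 1 / K%:R = k.+1%:R / K%:R - k%:R / K%:R :> R.
    by rewrite -mulrBl -natr1; congr (_ / _); ring.
  apply: le_trans (Q_hybrid mf r14 _ _ _) _.
  - by rewrite divr_ge0.
  - by rewrite ler_pM2r ?invr_gt0 // ler_nat.
  - by rewrite ler_pdivrMr // mul1r ler_nat.
  apply: ler_wpM2l.
    by rewrite -mulrBl !divr_ge0 // subr_ge0 ler_nat.
  rewrite mulr_suml; apply: ler_sum => i _.
  have n0 := N_ge0 i br mf.
  have e0 : 0 <= k%:R / K%:R / 64 :> R by rewrite !divr_ge0.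
  rewrite powRD ?powRr1 //; last by apply/implyP => /eqP; lra.
  apply: ler_wpM2l => //.
  (* The power [k / (64 K)] of the bound [2^(-64 K)] on the influences is [2^-k]. *)
  apply: (@le_trans _ _ (((1 / 2 : R) ^+ (64 * K)) `^ (k%:R / K%:R / 64))).
    by apply: ge0_ler_powR; rewrite ?nnegrE ?exprn_ge0 ?divr_ge0 //; exact: hN.
  have -> : (1 / 2 : R) ^+ (64 * K) = (1 / 2) `^ (64 * K)%:R.
    by rewrite powR_mulrn // divr_ge0.
  rewrite -powRrM.
  have -> : (64 * K)%:R * (k%:R / K%:R / 64) = k%:R :> R.
    by rewrite natrM; field; rewrite gt_eqF.
  by rewrite powR_mulrn // divr_ge0.
apply: (@le_trans _ _ (2 * K%:R * \sum_(k < K) (1 / K%:R) / 4 * (I * (1 / 2) ^+ k))).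
  by apply: ler_wpM2l; [rewrite mulr_ge0 | exact: ler_sum].
rewrite -mulr_sumr -mulr_sumr.
have -> : 2 * K%:R * (1 / K%:R / 4 * (I * \sum_(k < K) (1 / 2) ^+ k)) =
  I * (\sum_(k < K) (1 / 2) ^+ k) / 2 by field; rewrite gt_eqF.
by have := ler_wpM2l I0 (sum_half_pow K); lra.
Qed.

End KKL.

(** * Decision trees *)

Section Trees.
Variables (R : realType) (T : finType).
Implicit Types (p : T -> R) (f g : cube T -> bool) (t : dtree T).

Fixpoint prune (i : T) (b : bool) t : dtree T :=
  match t with
  | Leaf c => Leaf c
  | Query j t0 t1 =>
      if j == i then (if b then prune i b t1 else prune i b t0)
      else Query j (prune i b t0) (prune i b t1)
  end.

Lemma depth_prune i b t : (depth (prune i b t) <= depth t)%N.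
Proof.
elim: t => [c //|j t0 IH0 t1 IH1] /=; case: ifP => _.
  by case: b IH0 IH1 => IH0 IH1; apply: leqW; rewrite leq_max ?IH0 ?IH1 ?orbT.
by rewrite /= ltnS geq_max !leq_max IH0 IH1 orbT.
Qed.

Lemma dt_eval_prune i b t : dt_eval (prune i b t) = sub (dt_eval t) i b.
Proof.
apply/funext => x; rewrite /sub; elim: t => [//|j t0 IH0 t1 IH1] /=.
case: (eqVneq j i) => [->|ji]; first by rewrite upd_eq; case: b IH0 IH1.
by rewrite /= ffunE (negPf ji) IH0 IH1.
Qed.

Lemma sub_query i b t0 t1 :
  sub (dt_eval (Query i t0 t1)) i b = dt_eval (prune i b (if b then t1 else t0)).
Proof.
by rewrite dt_eval_prune; apply/funext => x; rewrite /sub /= upd_eq; case: b.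
Qed.

(* Overwriting the queried bit inside [f], but not inside the tree, costs at most
   a quarter of an influence of [f] per query. *)
Lemma tree_covariance (n : nat) t p f (u : R) : bias p -> monotone f ->
    (forall i, N p f i <= u) -> 0 <= u -> (depth t <= n)%N ->
  `|Ex p (fun x => (f x)%:R * (dt_eval t x)%:R) - M p f * M p (dt_eval t)|
     <= n%:R * u / 4.
Proof.
move=> hp mf hu u0; elim: n t => [|n IHn] [c|i t0 t1] //=.
- by move=> _; under eq_Ex do rewrite mulrC; rewrite /M ExZ Ex_cst mulrC subrr normr0
     !mul0r.
- move=> _; under eq_Ex do rewrite mulrC; rewrite /M ExZ Ex_cst mulrC subrr normr0.
  by rewrite !mulr_ge0 // invr_ge0.
rewrite ltnS geq_max => /andP[d0 d1].
set g := dt_eval (Query i t0 t1).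
have h1 := IHn _ (leq_trans (depth_prune i true t1) d1).
have h0 := IHn _ (leq_trans (depth_prune i false t0) d0).
have s1 : dt_eval (prune i true t1) = sub g i true by rewrite /g (sub_query i true).
have s0 : dt_eval (prune i false t0) = sub g i false by rewrite /g (sub_query i false).
rewrite s1 in h1; rewrite s0 in h0.
pose E (f' g' : cube T -> bool) := Ex p (fun x => (f' x)%:R * (g' x)%:R : R).
rewrite -/(E f _) in h1; rewrite -/(E f _) in h0; rewrite -/(E f g).
pose f1 := sub f i true; pose f0 := sub f i false.
pose g1 := sub g i true; pose g0 := sub g i false.
rewrite -/g1 in h1; rewrite -/g0 in h0.
have Es : E f g = p i * E f1 g1 + (1 - p i) * E f0 g0 by exact: (Ex_split i).
have Es1 : E f g1 = p i * E f1 g1 + (1 - p i) * E f0 g1.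
  by rewrite {1}/E (Ex_split i); congr (_ * _ + _ * _); apply: eq_Ex => x;
    rewrite /f1 /f0 /g1 /sub ?upd_upd.
have Es0 : E f g0 = p i * E f1 g0 + (1 - p i) * E f0 g0.
  by rewrite {1}/E (Ex_split i); congr (_ * _ + _ * _); apply: eq_Ex => x;
    rewrite /f1 /f0 /g0 /sub ?upd_upd.
have Dg : `|(E f1 g1 - E f0 g1) - (E f1 g0 - E f0 g0)| <= u.
  have -> : (E f1 g1 - E f0 g1) - (E f1 g0 - E f0 g0) =
      Ex p (fun x => diff R f i x * ((g1 x)%:R - (g0 x)%:R)).
    by rewrite /E -!ExB; apply: eq_Ex => x; rewrite /diff /f1 /f0; ring.
  apply: le_trans (Ex_norm _ hp) _; apply: le_trans (hu i); rewrite -Ex_diff.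
  apply: Ex_le => // x; have /andP[dp _] := diff_bound R i x mf.
  rewrite normrM (ger0_norm dp); apply: ler_piMr => //.
  by case: (g1 x) (g0 x) => [] [] /=; rewrite ?subrr ?subr0 ?sub0r ?normrN ?normr0 ?normr1.
have Mg : M p g = p i * M p g1 + (1 - p i) * M p g0 by exact: M_split.
have /andP[p0 p1] := hp i.
have p14 : p i * (1 - p i) <= 1 / 4 by have := sqr_ge0 (p i - 1 / 2); lra.
have p00 : 0 <= p i * (1 - p i) by rewrite mulr_ge0 // subr_ge0.
set D := _ - _ in Dg.
have -> : E f g - M p f * M p g = p i * (E f g1 - M p f * M p g1) +
   (1 - p i) * (E f g0 - M p f * M p g0) + p i * (1 - p i) * D.
  by rewrite /D Es1 Es0 Es Mg; ring.
apply: le_trans (ler_normD _ _) _; apply: le_trans (lerD (ler_normD _ _) (lexx _)) _.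
rewrite !normrM (ger0_norm p0) (ger0_norm (x := 1 - p i)) ?subr_ge0 //.
have k1 := ler_wpM2l p0 h1.
have k0 : (1 - p i) * `|E f g0 - M p f * M p g0| <= (1 - p i) * (n%:R * u / 4).
  by apply: ler_wpM2l; rewrite ?subr_ge0.
have k2 := ler_pM p00 (normr_ge0 D) p14 Dg.
by rewrite -natr1; lra.
Qed.

(** Changing the bias shifts a weight [v - u] between the two subtrees of the root, whose means
    differ by at most 1; the rest is the induction hypothesis for the subtrees. *)
Lemma tree_lipschitz (n : nat) t (u v : R) : 0 <= u -> u <= v -> v <= 1 ->
    (depth t <= n)%N ->
  `|M (fun=> v) (dt_eval t) - M (fun=> u) (dt_eval t)| <= n%:R * (v - u).
Proof.
move=> u0 uv v1; elim: n t => [|n IHn] [c|i t0 t1] //=.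
- by move=> _; rewrite /M !Ex_cst subrr normr0 mul0r.
- by move=> _; rewrite /M !Ex_cst subrr normr0 mulr_ge0 // subr_ge0.
rewrite ltnS geq_max => /andP[d0 d1].
have h1 := IHn _ (leq_trans (depth_prune i true t1) d1).
have h0 := IHn _ (leq_trans (depth_prune i false t0) d0).
set g := dt_eval (Query i t0 t1).
have s1 : dt_eval (prune i true t1) = sub g i true by rewrite /g (sub_query i true).
have s0 : dt_eval (prune i false t0) = sub g i false by rewrite /g (sub_query i false).
rewrite s1 in h1; rewrite s0 in h0.
rewrite (M_split i (fun=> v)) (M_split i (fun=> u)).
have bu : bias (fun=> u : R) (T := T) by move=> j; apply/andP; split; lra.
have a0 := M_ge0 (sub g i true) bu; have a1 := M_le1 (sub g i true) bu.
have b0 := M_ge0 (sub g i false) bu; have b1 := M_le1 (sub g i false) bu.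
set x := M (fun=> u) (sub g i true) in h1 a0 a1 *.
set y := M (fun=> u) (sub g i false) in h0 b0 b1 *.
set x' := M _ (sub g i true) in h1 *; set y' := M _ (sub g i false) in h0 *.
have -> : v * x' + (1 - v) * y' - (u * x + (1 - u) * y) =
  v * (x' - x) + (1 - v) * (y' - y) + (v - u) * (x - y) by ring.
apply: le_trans (ler_normD _ _) _; apply: le_trans (lerD (ler_normD _ _) (lexx _)) _.
have v0 : 0 <= v by lra.
rewrite !normrM (ger0_norm v0) (ger0_norm (x := 1 - v)) ?subr_ge0 //.
rewrite (ger0_norm (x := v - u)) ?subr_ge0 //.
have xy : `|x - y| <= 1 by rewrite ler_norml; apply/andP; split; lra.
have k1 := ler_wpM2l v0 h1.
have k0 : (1 - v) * `|y' - y| <= (1 - v) * (n%:R * (v - u)).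
  by apply: ler_wpM2l; rewrite ?subr_ge0.
have k2 : (v - u) * `|x - y| <= (v - u) * 1 by apply: ler_wpM2l; rewrite ?subr_ge0.
by rewrite -natr1; lra.
Qed.

(** [tree_covariance] applied to a function and its own tree: the covariance of a function with
    itself is its variance. *)
Lemma tree_variance (n : nat) t p (u : R) : bias p -> monotone (dt_eval t) ->
    (forall i, N p (dt_eval t) i <= u) -> 0 <= u -> (depth t <= n)%N ->
  M p (dt_eval t) * (1 - M p (dt_eval t)) <= n%:R * u / 4.
Proof.
move=> hp mf hu u0 dn; apply: le_trans (tree_covariance hp mf hu u0 dn).
apply: le_trans (ler_norm _); rewrite mulrBr mulr1 le_eqVlt; apply/orP; left.
by apply/eqP; congr (_ - _); apply: eq_Ex => x; case: (dt_eval t x); rewrite /= ?mulr1 ?mulr0.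
Qed.

End Trees.

(** * Adaptive fixing of influential coordinates *)

Section Reveal.
Variables (R : realType) (T : finType).
Implicit Types (f g : cube T -> bool) (t : dtree T).

(** The tree may query all of [T], dead coordinates included; this avoids the dependent type of
    [restrict], and [DT_bad] relates the two. *)
Definition bad (d : R) f (B z : cube T) : Prop :=
  exists2 t, (depth t)%:R < d & dt_eval t =1 (fun y => f (mix B y z)).

Definition Vbad (rho d : R) f : R :=
  ER (fun=> rho) (fun=> 1 / 2) (fun B z => (`[< bad d f B z >])%:R).

Variables (rho d : R).
Hypothesis rho01 : 0 <= rho <= 1.

Let bias_rho : bias (fun=> rho : R) (T := T). Proof. by []. Qed.

Lemma bias_half : bias (fun=> 1 / 2 : R) (T := T).
Proof. by move=> i; apply/andP; split; lra. Qed.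

Lemma Vbad_le1 f : Vbad rho d f <= 1.
Proof.
rewrite -[leRHS](ER_cst (fun=> rho) (fun=> 1 / 2) (T := T)).
by apply: ER_le => // [|B z]; [exact: bias_half | case: `[< _ >]].
Qed.

(** When [i] is dead its value is uniform anyway; when it is live, fixing it does not increase the
    depth ([prune]). *)
Lemma Vbad_reveal i f :
  Vbad rho d f <= (Vbad rho d (sub f i true) + Vbad rho d (sub f i false)) / 2.
Proof.
have /andP[r0 r1] := rho01.
rewrite {1}/Vbad (ER_split i).
have h1 b : ER (fun=> rho) (fun=> 1 / 2)
    (fun B z => (`[< bad d f (upd B i true) z >])%:R) <= Vbad rho d (sub f i b).
  apply: ER_le => // [|B z]; first exact: bias_half.
  rewrite ler_nat; case: asboolP => // -[t dt et].
  case: asboolP => // -[]; exists (prune i b t).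
    by apply: le_lt_trans dt; rewrite ler_nat depth_prune.
  by move=> y; rewrite dt_eval_prune /sub et mix_true.
have h0 b : ER (fun=> rho) (fun=> 1 / 2)
    (fun B z => (`[< bad d f (upd B i false) (upd z i b) >])%:R) <=
    Vbad rho d (sub f i b).
  apply: ER_le => // [|B z]; first exact: bias_half.
  rewrite ler_nat; case: asboolP => // -[t dt et].
  case: asboolP => // -[]; exists t => // y.
  by rewrite et mix_false.
have := ler_wpM2l r0 (h1 true); have := ler_wpM2l r0 (h1 false).
have r1' : 0 <= 1 - rho by rewrite subr_ge0.
have := ler_wpM2l r1' (h0 true); have := ler_wpM2l r1' (h0 false).
lra.
Qed.

Local Notation E := (@Ex R T (fun=> 1 / 2)).

(* [t1] and [t2] mark the leaves at which the mean of [f] has dropped below [v]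
   or risen above [1 - v], and [u] is the probability of still having a function
   that is not [good] after [l] queries.  The second clause (no query to an
   irrelevant coordinate) makes the subtrees independent of the root query. *)
Lemma reveal (good : (cube T -> bool) -> Prop) (Pot : (cube T -> bool) -> R)
    (eta v c : R) : 0 < eta -> 0 <= c ->
    (forall f, monotone f -> 0 <= Pot f) ->
    (forall f, monotone f -> ~ good f -> exists i,
       (Pot (sub f i true) + Pot (sub f i false)) / 2 <= Pot f - eta) ->
    (forall f, monotone f -> good f -> v <= E (fun x => (f x)%:R) <= 1 - v ->
       Vbad rho d f <= c) ->
  forall (l : nat) f, monotone f -> exists t1 t2 (u : R),
  [/\ [/\ (depth t1 <= l)%N, (depth t2 <= l)%N, 0 <= u <= 1 & l%:R * eta * u <= Pot f],
      (forall j, (forall b, sub f j b = f) -> forall b,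
         sub (dt_eval t1) j b = dt_eval t1 /\ sub (dt_eval t2) j b = dt_eval t2),
      E (fun x => (f x)%:R * (dt_eval t1 x)%:R) <= v * M (fun=> 1 / 2) (dt_eval t1),
      E (fun x => (1 - (f x)%:R) * (dt_eval t2 x)%:R) <=
        v * M (fun=> 1 / 2) (dt_eval t2) &
      Vbad rho d f <= c + M (fun=> 1 / 2) (dt_eval t1) + M (fun=> 1 / 2) (dt_eval t2) + u].
Proof.
move=> eta0 c0 Pot0 Pdec Vgood.
have leafE b : M (fun=> 1 / 2 : R) (dt_eval (Leaf b) : cube T -> bool) = b%:R.
  by rewrite /M Ex_cst.
have E0 (h : cube T -> R) : E (fun x => h x * (dt_eval (Leaf false) x)%:R) = 0.
  by under eq_Ex do rewrite mulr0; rewrite Ex_cst.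
have E1 (h : cube T -> R) : E (fun x => h x * (dt_eval (Leaf true) x)%:R) = E h.
  by apply: eq_Ex => x; rewrite mulr1.
have stop (l : nat) f (b1 b2 : bool) (u : R) : monotone f -> 0 <= u <= 1 ->
    l%:R * eta * u <= Pot f -> Vbad rho d f <= c + b1%:R + b2%:R + u ->
    (b1 -> E (fun x => (f x)%:R) <= v) ->
    (b2 -> 1 - v <= E (fun x => (f x)%:R)) -> exists t1 t2 (u : R),
  [/\ [/\ (depth t1 <= l)%N, (depth t2 <= l)%N, 0 <= u <= 1 & l%:R * eta * u <= Pot f],
      (forall j, (forall b, sub f j b = f) -> forall b,
         sub (dt_eval t1) j b = dt_eval t1 /\ sub (dt_eval t2) j b = dt_eval t2),
      E (fun x => (f x)%:R * (dt_eval t1 x)%:R) <= v * M (fun=> 1 / 2) (dt_eval t1),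
      E (fun x => (1 - (f x)%:R) * (dt_eval t2 x)%:R) <=
        v * M (fun=> 1 / 2) (dt_eval t2) &
      Vbad rho d f <= c + M (fun=> 1 / 2) (dt_eval t1) + M (fun=> 1 / 2) (dt_eval t2) + u].
  move=> mf u01 uP Vu h1 h2; exists (Leaf b1), (Leaf b2), u; split; rewrite ?leafE //.
    by case: b1 h1 {Vu} => [/(_ isT)|_]; rewrite ?E1 ?E0 ?mulr1 ?mulr0.
  case: b2 h2 {Vu} => [/(_ isT)|_]; rewrite ?E1 ?E0 ?mulr1 ?mulr0 //.
  by rewrite ExB Ex_cst; lra.
elim=> [|l IHl] f mf.
  apply: (stop 0%N f false false 1) => //; first by rewrite ler01 lexx.
    by rewrite !mul0r Pot0.
  by have := Vbad_le1 f; rewrite mulr0n; lra.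
have [low|low] := ltP (E (fun x => (f x)%:R)) v.
  apply: (stop _ f true false 0) => //; rewrite ?lexx ?ler01 ?mulr0 ?Pot0 //.
    by have := Vbad_le1 f; rewrite mulr1n mulr0n; lra.
  by move=> _; exact: ltW.
have [high|high] := ltP (1 - v) (E (fun x => (f x)%:R)).
  apply: (stop _ f false true 0) => //; rewrite ?lexx ?ler01 ?mulr0 ?Pot0 //.
    by have := Vbad_le1 f; rewrite mulr1n mulr0n; lra.
  by move=> _; exact: ltW.
have [gf|gf] := pselect (good f).
  apply: (stop _ f false false 0) => //; rewrite ?lexx ?ler01 ?mulr0 ?Pot0 //.
  by have := Vgood f mf gf; rewrite low high => /(_ isT); rewrite mulr0n; lra.
have [i Pi] := Pdec f mf gf.
have [a1 [a2 [u1 [[da1 da2 /andP[u10 u11] up1] ia ea1 ea2 va]]]] :=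
  IHl _ (monotone_sub i true mf).
have [b1 [b2 [u2 [[db1 db2 /andP[u20 u21] up2] ib eb1 eb2 vb]]]] :=
  IHl _ (monotone_sub i false mf).
have qi (a b : dtree T) : (forall c, sub (dt_eval a) i c = dt_eval a) ->
    (forall c, sub (dt_eval b) i c = dt_eval b) ->
    sub (dt_eval (Query i b a)) i true = dt_eval a /\
    sub (dt_eval (Query i b a)) i false = dt_eval b.
  by move=> ha hb; rewrite !sub_query !dt_eval_prune.
have ii b c' : sub (sub f i b) i c' = sub f i b by exact: sub_sub.
have ia1 c' := (ia i (ii true) c').1; have ia2 c' := (ia i (ii true) c').2.
have ib1 c' := (ib i (ii false) c').1; have ib2 c' := (ib i (ii false) c').2.
have [q11 q10] := qi a1 b1 ia1 ib1; have [q21 q20] := qi a2 b2 ia2 ib2.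
have Msp a b : sub (dt_eval (Query i b a)) i true = dt_eval a ->
    sub (dt_eval (Query i b a)) i false = dt_eval b ->
    M (fun=> 1 / 2 : R) (dt_eval (Query i b a)) =
    (M (fun=> 1 / 2) (dt_eval a) + M (fun=> 1 / 2) (dt_eval b)) / 2.
  by move=> ha hb; rewrite (M_split i) ha hb; field.
exists (Query i b1 a1), (Query i b2 a2), ((u1 + u2) / 2).
rewrite (Msp _ _ q11 q10) (Msp _ _ q21 q20); split.
- split => /=; rewrite ?ltnS ?geq_max ?da1 ?da2 ?db1 ?db2 //.
    by apply/andP; split; lra.
  (* The query itself lowers the averaged potential by [eta], which pays for the extra [eta] times
     the new [u]. *)
  rewrite -natr1; have : eta * ((u1 + u2) / 2) <= eta by rewrite ger_pMr //; lra.
  lra.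
- move=> j fj.
  (* Fixing an irrelevant coordinate would leave [Pot] unchanged, against the drop by [eta]. *)
  have ji : i != j.
    apply/eqP => ij; move: Pi; rewrite ij !fj.
    by lra.
  have sj b c' : sub (sub f i b) j c' = sub f i b.
    apply/funext => x; rewrite /sub upd_comm 1?eq_sym //.
    exact: (congr1 (fun g => g (upd x i b)) (fj c')).
  move=> b; have [j1 j2] := ia j (sj true) b; have [j3 j4] := ib j (sj false) b.
  have ev (a a' : dtree T) : sub (dt_eval a) j b = dt_eval a ->
      sub (dt_eval a') j b = dt_eval a' ->
      sub (dt_eval (Query i a' a)) j b = dt_eval (Query i a' a).
    move=> e1 e2; apply/funext => x; rewrite /sub /= ffunE (negPf ji).
    have := congr1 (fun g => g x) e1; have := congr1 (fun g => g x) e2.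
    by rewrite /sub => -> ->.
  by rewrite !ev.
- rewrite (Ex_split i) /=.
  have -> : sub (fun x => (f x)%:R * (dt_eval (Query i b1 a1) x)%:R : R) i true =
     (fun x => (sub f i true x)%:R * (dt_eval a1 x)%:R) by rewrite -q11.
  have -> : sub (fun x => (f x)%:R * (dt_eval (Query i b1 a1) x)%:R : R) i false =
     (fun x => (sub f i false x)%:R * (dt_eval b1 x)%:R) by rewrite -q10.
  by lra.
- rewrite (Ex_split i) /=.
  have -> : sub (fun x => (1 - (f x)%:R) * (dt_eval (Query i b2 a2) x)%:R : R) i true =
     (fun x => (1 - (sub f i true x)%:R) * (dt_eval a2 x)%:R) by rewrite -q21.
  have -> : sub (fun x => (1 - (f x)%:R) * (dt_eval (Query i b2 a2) x)%:R : R) i false =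
     (fun x => (1 - (sub f i false x)%:R) * (dt_eval b2 x)%:R) by rewrite -q20.
  by lra.
- by have := Vbad_reveal i f; lra.
Qed.

(** At the leaves marked by [t1] the mean of [f] is at most [v], while by [tree_covariance] it is on
    average nearly [M f >= 2 v]; so [v] times the mass of [t1] is at most [l u / 4], and likewise
    for [t2]. The potential bounds the mass of the unfinished leaves. *)
Lemma reveal_bound (good : (cube T -> bool) -> Prop) (Pot : (cube T -> bool) -> R)
    (eta v c u : R) (l : nat) f : 0 < eta -> 0 <= c -> 0 < v -> (0 < l)%N ->
    (forall f, monotone f -> 0 <= Pot f) ->
    (forall f, monotone f -> ~ good f -> exists i,
       (Pot (sub f i true) + Pot (sub f i false)) / 2 <= Pot f - eta) ->
    (forall f, monotone f -> good f -> v <= E (fun x => (f x)%:R) <= 1 - v ->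
       Vbad rho d f <= c) ->
    monotone f -> 2 * v <= E (fun x => (f x)%:R) <= 1 - 2 * v ->
    0 <= u -> (forall i, N (fun=> 1 / 2) f i <= u) ->
  Vbad rho d f <= c + l%:R * u / (2 * v) + Pot f / (l%:R * eta).
Proof.
move=> eta0 c0 v0 l0 Pot0 Pdec Vgood mf /andP[Ef0 Ef1] u0 hu.
have [t1 [t2 [w [[d1 d2 /andP[w0 w1] wP] _ e1 e2 Vw]]]] :=
  reveal eta0 c0 Pot0 Pdec Vgood l mf.
have l0' : 0 < l%:R :> R by rewrite ltr0n.
have c1 := tree_covariance bias_half mf hu u0 d1.
have c2 := tree_covariance bias_half mf hu u0 d2.
have e2' : E (fun x => (1 - (f x)%:R) * (dt_eval t2 x)%:R) =
    M (fun=> 1 / 2) (dt_eval t2) - E (fun x => (f x)%:R * (dt_eval t2 x)%:R).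
  by rewrite /M -ExB; apply: eq_Ex => x; ring.
rewrite e2' in e2; move: c1 c2; rewrite !ler_norml => /andP[c1 _] /andP[_ c2].
rewrite -/(M _ f) in Ef0 Ef1.
have m1 := M_ge0 (dt_eval t1) bias_half; have m2 := M_ge0 (dt_eval t2) bias_half.
set x1 := M _ (dt_eval t1) in e1 c1 m1 Vw; set x2 := M _ (dt_eval t2) in e2 c2 m2 Vw.
have wb : w <= Pot f / (l%:R * eta).
  by rewrite ler_pdivlMr ?mulr_gt0 //; lra.
have k1 : 2 * v * x1 <= M (fun=> 1 / 2) f * x1 by exact: ler_wpM2r.
have k2 : 2 * v * x2 <= (1 - M (fun=> 1 / 2) f) * x2 by apply: ler_wpM2r => //; lra.
have b1 : x1 + x2 <= l%:R * u / (2 * v).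
  by rewrite ler_pdivlMr ?mulr_gt0 //; lra.
lra.
Qed.

End Reveal.

(** * Functions without influential coordinates *)

Section Leaf.
Variables (R : realType) (T : finType).
Implicit Types (f g : cube T -> bool) (t : dtree T).

(** The step hypothesis amounts to [(1 + eta) m_j (1 - m_{j+1}) <= m_{j+1} (1 - m_j)]: each step
    multiplies the odds [m / (1 - m)] by at least [1 + eta]. The cross-multiplied form allows the
    values 0 and 1. *)
Lemma odds_growth (eta : R) (m : nat -> R) (J : nat) : 0 <= eta ->
    (forall j, 0 <= m j <= 1) ->
    (forall j, (j < J)%N -> eta * (m j * (1 - m j.+1)) <= m j.+1 - m j) ->
  (1 + eta) ^+ J * (m 0%N * (1 - m J)) <= m J * (1 - m 0%N).
Proof.
move=> e0 m01; elim: J => [|J IHJ] step; first by rewrite expr0 mul1r lexx.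
have {}IHJ := IHJ (fun j jJ => step j (ltnW jJ)).
have {}step := step J (ltnSn J).
have /andP[a0 a1] := m01 0%N; have /andP[b0 b1] := m01 J; have /andP[c0 c1] := m01 J.+1.
set a := m 0%N in IHJ a0 a1 *; set b := m J in IHJ step b0 b1.
set c := m J.+1 in step c0 c1 *.
have X0 : 0 <= (1 + eta) ^+ J by apply: exprn_ge0; lra.
have E0 : (1 + eta) * (b * (1 - c)) <= c * (1 - b) by lra.
rewrite exprSr; set X := (1 + eta) ^+ J in IHJ X0 *.
have [b00|bn0] := eqVneq b 0.
  have Pa : X * a <= 0 by move: IHJ; rewrite b00; lra.
  have : X * a * ((1 + eta) * (1 - c)) <= 0.
    by apply: mulr_le0_ge0 => //; rewrite mulr_ge0 //; lra.
  have : 0 <= c * (1 - a) by rewrite mulr_ge0 //; lra.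
  lra.
have [b11|bn1] := eqVneq b 1.
  have ec : 0 <= eta * (1 - c) by rewrite mulr_ge0 // subr_ge0.
  have -> : c = 1 by move: E0; rewrite b11; lra.
  by rewrite subrr !mulr0 mul1r subr_ge0.
have bp : 0 < b * (1 - b).
  by apply: mulr_gt0; rewrite ?subr_gt0 lt_neqAle ?[0 == _]eq_sym ?bn0 ?bn1.
have l0 : 0 <= X * (a * (1 - b)) by rewrite !mulr_ge0 //; lra.
have l1 : 0 <= (1 + eta) * (b * (1 - c)) by rewrite !mulr_ge0 //; lra.
have h := ler_pM l0 l1 IHJ E0.
by rewrite -(ler_pM2l bp); lra.
Qed.

(* The mean of a shallow tree is Lipschitz in the bias, so on its way from 1/4 to
   3/4 it cannot jump over the test biases [q b]. *)
Lemma bad_influential (d : R) (Bk : nat) (q : nat -> R) f (B z : cube T) :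
    monotone f -> 0 < d -> (0 < Bk)%N -> 2 * d <= Bk%:R ->
    (forall b, (b < Bk + Bk)%N ->
       1 / 4 + b%:R / (4 * Bk%:R) <= q b <= 1 / 4 + b.+1%:R / (4 * Bk%:R)) ->
    bad d f B z ->
    Rm (fun=> 1 / 4) (fun x => (f x)%:R) B z <= 1 / 4 :> R ->
    3 / 4 <= Rm (fun=> 3 / 4) (fun x => (f x)%:R) B z :> R ->
  exists2 b, (b < Bk + Bk)%N &
    exists i, 3 / (4 * d) <= Rm (fun=> q b) (diff R f i) B z.
Proof.
move=> mf d0 Bk0 dBk hq [t td et]; set n := depth t in td.
have BR : 0 < Bk%:R :> R by rewrite ltr0n.
set g := dt_eval t in et.
have gE : g = fun y => f (mix B y z) by apply/funext.
have RE (u : R) : Rm (fun=> u) (fun x => (f x)%:R) B z = M (fun=> u) g.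
  by rewrite gE.
have mg : monotone g.
  move=> x y xy; rewrite gE; apply: mf => i; rewrite !ffunE; by case: (B i).
rewrite !RE => lo hi.
pose e b : R := 1 / 4 + b%:R / (4 * Bk%:R).
have e0 : e 0%N = 1 / 4 by rewrite /e mul0r addr0.
have e2 : e (Bk + Bk)%N = 3 / 4.
  by rewrite /e natrD; field; rewrite gt_eqF.
have eS b : e b.+1 - e b = 1 / (4 * Bk%:R).
  by rewrite /e -natr1; field; rewrite gt_eqF.
have ele b c : (b <= c)%N -> e b <= e c.
  by move=> bc; rewrite lerD2l ler_pM2r ?invr_gt0 ?mulr_gt0 // ler_nat.
have exb : exists c, (1 / 2 <= M (fun=> e c) g) && (c <= Bk + Bk)%N.
  by exists (Bk + Bk)%N; rewrite e2 leqnn andbT; lra.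
case: (ex_minnP exb) => -[|b] /andP[hc cB] cmin; first by move: hc; rewrite e0; lra.
have hb : M (fun=> e b) g < 1 / 2.
  rewrite ltNge; apply/negP => hb.
  by have := cmin b; rewrite hb (ltnW cB) ltnn => /(_ isT).
exists b => //.
have /andP[qb1 qb2] := hq b cB; rewrite -/(e b) -/(e b.+1) in qb1 qb2.
have := ele _ _ (leq0n b); have := ele _ _ cB; rewrite e0 e2 => eb1 eb0.
have lip := @tree_lipschitz R T n t (e b) (e b.+1) _ _ _ (leqnn _).
have {lip} : `|M (fun=> e b.+1) g - M (fun=> e b) g| <= n%:R * (e b.+1 - e b).
  by apply: lip; have := ele _ _ (leqnSn b); lra.
rewrite ler_norml eS => /andP[_ lip].
(* [n < d <= Bk / 2], so the mean of the tree moves by at most 1/8 inside one block and lies in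
   [[3/8, 5/8]] at [q b]. *)
have lip8 : n%:R * (1 / (4 * Bk%:R)) <= 1 / 8 :> R.
  by rewrite mulrA mulr1 ler_pdivrMr ?mulr_gt0 //; lra.
have q1 : M (fun=> e b) g <= M (fun=> q b) g by apply: M_le => //; lra.
have q2 : M (fun=> q b) g <= M (fun=> e b.+1) g by apply: M_le => //; lra.
have bq : bias (fun=> q b) (T := T) by move=> i; apply/andP; split; lra.
apply: contrapT => /forallNP noi.
have u0 : 0 <= 3 / (4 * d) by rewrite divr_ge0 ?mulr_ge0 ?(ltW d0).
have hN i : N (fun=> q b) g i <= 3 / (4 * d).
  have /negP := noi i; rewrite -ltNge => /ltW; apply: le_trans.
  rewrite -Ex_diff /Rm; apply: Ex_le => // y.
  rewrite gE /diff /sub; case Bi: (B i).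
    have mE b' : mix B (upd y i b') z = upd (mix B y z) i b'.
      by rewrite -[in LHS](upd_id B i) Bi mix_true.
    by rewrite !mE.
  have mE b' : mix B (upd y i b') z = mix B y z.
    by apply/ffunP => j; rewrite !ffunE; case: eqP => // ->; rewrite Bi.
  by rewrite !mE subrr; have /andP[] := diff_bound R i (mix B y z) mf.
(* Influences below [3 / (4 d)] would force the variance to be at most 3/16, whereas it is at least
   15/64 for a mean in [[3/8, 5/8]]. *)
have := tree_variance bq mg hN u0 (leqnn _); rewrite -/g -/n.
have nu : n%:R * (3 / (4 * d)) / 4 <= 3 / 16.
  rewrite mulrA ler_pdivrMr // ler_pdivrMr ?mulr_gt0 //; lra.
set x := M (fun=> q b) g in q1 q2 *.
have x1 : 3 / 8 <= x by lra.
have x2 : x <= 5 / 8 by lra.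
have : 0 <= (x - 3 / 8) * (5 / 8 - x) by rewrite mulr_ge0 //; lra.
lra.
Qed.

(** * The grid of biases and its potential *)

Variables (rho d theta : R) (L Bk K : nat).
Hypotheses (rho0 : 0 < rho) (rho1 : rho <= 1) (d0 : 0 < d).
Hypotheses (L0 : (0 < L)%N) (Bk0 : (0 < Bk)%N) (K0 : (0 < K)%N).
(** The grid covers [[1/2 - rho/4, 1/2 + rho/4]], the overall biases obtained when live coordinates
    have biases from 1/4 to 3/4 and dead ones are uniform. Its [2 * ngrid] steps of length [kappa]
    form [2 * Bk] blocks of [L] steps, with one test bias per block. *)
Definition ngrid := (L * Bk)%N.
Definition kappa : R := rho / (4 * ngrid%:R).
Hypotheses (theta0 : 0 < theta) (Ltheta : 1 <= L%:R * theta).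
Hypothesis thetaK : 5 * theta <= (1 / 2) ^+ (64 * K).
Hypothesis dBk : 2 * d <= Bk%:R.
Hypothesis Keta : 2 * K%:R * kappa <= theta.

Definition Mu (u : R) f : R := M (fun=> u) f.
Definition pt (j : nat) : R := 1 / 2 - rho / 4 + j%:R * kappa.

Let G0 : 0 < ngrid%:R :> R. Proof. by rewrite ltr0n muln_gt0 L0. Qed.
Let kappa0 : 0 < kappa. Proof. by rewrite divr_gt0 ?mulr_gt0. Qed.
Let Gkappa : ngrid%:R * kappa = rho / 4.
Proof. by rewrite /kappa; field; rewrite gt_eqF. Qed.

Let ptG j : pt (ngrid + j) = 1 / 2 + j%:R * kappa.
Proof. by rewrite /pt natrD mulrDl Gkappa; ring. Qed.

Let pt_sub (j : nat) : (j <= ngrid)%N -> pt (ngrid - j) = 1 / 2 - j%:R * kappa.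
Proof. by move=> jG; rewrite /pt natrB // mulrBl Gkappa; ring. Qed.

Let ptS j : pt j.+1 - pt j = kappa.
Proof. by rewrite /pt -natr1; ring. Qed.

Let pt_le i j : (i <= j)%N -> pt i <= pt j.
Proof. by move=> ij; rewrite lerD2l ler_pM2r // ler_nat. Qed.

Let pt14 j : (j <= ngrid + ngrid)%N -> 1 / 4 <= pt j <= 3 / 4.
Proof.
have r0 := rho0; have r1 := rho1.
have p0 : pt 0 = 1 / 2 - rho / 4 by rewrite /pt mul0r addr0.
move=> jG; have := pt_le (leq0n j); have := pt_le jG; rewrite ptG Gkappa p0.
by move=> *; apply/andP; split; lra.
Qed.

(** The centre [pt ngrid = 1/2] is exempt: fixing a coordinate to a uniform bit preserves the mean
    at [1/2] on average, so a large influence there would give no drop of [potential]. *)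
Definition grid_small f := forall j, (j <= ngrid + ngrid)%N -> j != ngrid ->
  forall i, N (fun=> pt j) f i <= theta.

Definition potential f : R :=
  \sum_(j < ngrid) (Mu (1 / 2 + j.+1%:R * kappa) f - Mu (1 / 2 - j.+1%:R * kappa) f).

Let jk (j : 'I_ngrid) : 0 < j.+1%:R * kappa <= 1 / 4.
Proof.
have r0 := rho0; have r1 := rho1.
rewrite mulr_gt0 //=; have : j.+1%:R * kappa <= ngrid%:R * kappa.
  by rewrite ler_pM2r // ler_nat.
by rewrite Gkappa; lra.
Qed.

Lemma potential_ge0 f : monotone f -> 0 <= potential f.
Proof.
move=> mf; apply: sumr_ge0 => j _; rewrite subr_ge0; have /andP[? ?] := jk j.
by apply: M_le => //; lra.
Qed.

Lemma potential_le f : potential f <= ngrid%:R.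
Proof.
have -> : ngrid%:R = \sum_(j < ngrid) (1 : R) by rewrite sumr_const card_ord.
apply: ler_sum => j _; have /andP[? ?] := jk j.
have : Mu (1 / 2 + j.+1%:R * kappa) f <= 1 by apply: M_le1 => i; apply/andP; split; lra.
have : 0 <= Mu (1 / 2 - j.+1%:R * kappa) f by apply: M_ge0 => i; apply/andP; split; lra.
lra.
Qed.

(* Fixing [i] to a uniform bit instead of a [p]-biased one changes the mean under
   [mu_p] by [(1/2 - p)] times the influence, with the favourable sign on both
   sides of [1/2]. *)
Lemma potential_decrease f : monotone f -> ~ grid_small f -> exists i,
  (potential (sub f i true) + potential (sub f i false)) / 2
    <= potential f - kappa * theta.
Proof.
move=> mf /existsNP[j /not_implyP[jG /not_implyP[jnG /existsNP[i /negP]]]].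
rewrite -ltNge => hN; exists i.
have Pdrop (u : R) : Mu u f - (Mu u (sub f i true) + Mu u (sub f i false)) / 2 =
    (u - 1 / 2) * N (fun=> u) f i.
  by rewrite /Mu (M_split i) /N; field.
pose w (k : 'I_ngrid) := k.+1%:R * kappa *
  (N (fun=> 1 / 2 + k.+1%:R * kappa) f i + N (fun=> 1 / 2 - k.+1%:R * kappa) f i).
have -> : (potential (sub f i true) + potential (sub f i false)) / 2 =
    potential f - \sum_k w k.
  rewrite /potential -big_split /= mulr_suml -sumrB; apply: eq_bigr => k _.
  have := Pdrop (1 / 2 + k.+1%:R * kappa); have := Pdrop (1 / 2 - k.+1%:R * kappa).
  by rewrite /w; lra.
rewrite lerD2l lerN2.
have n0 (u : R) : 0 <= u <= 1 -> 0 <= N (fun=> u) f i by move=> ?; apply: N_ge0.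
have nk (k : 'I_ngrid) : 0 <= N (fun=> 1 / 2 + k.+1%:R * kappa) f i /\
   0 <= N (fun=> 1 / 2 - k.+1%:R * kappa) f i.
  by have /andP[? ?] := jk k; split; apply: n0; apply/andP; split; lra.
have w0 k : 0 <= w k.
  have /andP[h1 _] := jk k; have [h2 h3] := nk k.
  by rewrite /w; apply: mulr_ge0; [exact: ltW | exact: addr_ge0].
have [k hk] : exists k : 'I_ngrid, theta <= N (fun=> 1 / 2 + k.+1%:R * kappa) f i \/
    theta <= N (fun=> 1 / 2 - k.+1%:R * kappa) f i.
  have [Gj|jG'] := ltnP ngrid j.
    have jl : (j - ngrid.+1 < ngrid)%N by rewrite ltn_subLR // addSn ltnS.
    exists (Ordinal jl); left => /=.
    have <- : pt j = 1 / 2 + (j - ngrid.+1).+1%:R * kappa; last exact: ltW.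
    by rewrite subnSK // -ptG subnKC // ltnW.
  have jl : (ngrid - j.+1 < ngrid)%N by rewrite ltn_subrL /= muln_gt0 L0.
  have jG'' : (j < ngrid)%N by rewrite ltn_neqAle jnG.
  exists (Ordinal jl); right => /=.
  have <- : pt j = 1 / 2 - (ngrid - j.+1).+1%:R * kappa; last exact: ltW.
  by rewrite subnSK // -pt_sub ?leq_subr // subKn.
rewrite (bigD1 k) //=; apply: (@le_trans _ _ (w k)); last first.
  by rewrite lerDl sumr_ge0.
have k1 : kappa <= k.+1%:R * kappa by rewrite ler_peMl ?(ltW kappa0) // ler1n.
have [n1 n2] := nk k; rewrite /w; apply: ler_pM => //; try exact: ltW.
case: hk => hk; apply: le_trans hk _; [by rewrite lerDl | by rewrite lerDr].
Qed.

(** * Sharp threshold and depth when the grid influences are small *)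

Section GoodLeaf.
Variables (f : cube T -> bool) (v : R).
Hypotheses (mf : monotone f) (gf : grid_small f).
Hypotheses (v0 : 0 < v) (fv : v <= Mu (1 / 2) f <= 1 - v).

Definition gridM j := Mu (pt j) f.

Let m01 j : (j <= ngrid + ngrid)%N -> 0 <= gridM j <= 1.
Proof.
move=> jG; have /andP[? ?] := pt14 jG; apply/andP.
by split; [apply: M_ge0|apply: M_le1] => i; apply/andP; split; lra.
Qed.

Let m_le (j : nat) (u w : R) : (j < ngrid + ngrid)%N -> pt j <= u -> u <= w -> w <= pt j.+1 ->
  Mu u f <= Mu w f.
Proof.
move=> jG ju uw wj; have /andP[? ?] := pt14 jG; have /andP[? ?] := pt14 (ltnW jG).
by apply: M_le => //; lra.
Qed.

(** The end of the cell farther from the centre is not the centre itself, so its influences are at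
    most [theta]; [N_lipschitz] carries this bound to [w]. *)
Lemma influence_between (j : nat) (w : R) i : (j < ngrid + ngrid)%N -> pt j <= w -> w <= pt j.+1 ->
  N (fun=> w) f i <= theta + 4 * (gridM j.+1 - gridM j).
Proof.
move=> jG jw wj; have /andP[? ?] := pt14 jG; have /andP[? ?] := pt14 (ltnW jG).
have t0 := theta0.
have jwm : gridM j <= Mu w f by apply: (m_le jG); rewrite ?lexx.
have wjm : Mu w f <= gridM j.+1 by apply: (m_le jG); rewrite ?lexx.
have [Gj|jG'] := leqP ngrid j.
  have h : N (fun=> pt j.+1) f i <= theta by apply: gf => //; rewrite neq_ltn ltnS Gj orbT.
  have := N_lipschitz i mf (_ : 1 / 4 <= w) wj (_ : pt j.+1 <= 3 / 4).
  move=> /(_ ltac:(lra) ltac:(lra)); rewrite ler_norml => /andP[+ _].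
  by rewrite -/(Mu _ _) -/(Mu _ _) -/(gridM _); lra.
have h : N (fun=> pt j) f i <= theta by apply: gf; [exact: ltnW|rewrite neq_ltn jG'].
have := N_lipschitz i mf (_ : 1 / 4 <= pt j) jw (_ : w <= 3 / 4).
move=> /(_ ltac:(lra) ltac:(lra)); rewrite ler_norml => /andP[_ +].
by rewrite -/(Mu _ _) -/(Mu _ _) -/(gridM _); lra.
Qed.

(** If the mean rises by [theta] in the cell, [Keta] suffices. Otherwise all influences in the cell
    are at most [5 * theta], and KKL bounds from below the total influence, which is the slope of
    the mean by Russo's formula. *)
Lemma grid_step (j : nat) : (j < ngrid + ngrid)%N ->
  2 * K%:R * kappa * (gridM j * (1 - gridM j.+1)) <= gridM j.+1 - gridM j.
Proof.
move=> jG; have /andP[? ?] := pt14 jG; have /andP[? ?] := pt14 (ltnW jG).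
have /andP[a0 a1] := m01 jG; have /andP[b0 b1] := m01 (ltnW jG).
have K00 : 0 <= K%:R :> R by [].
have t0 := theta0; have tK := thetaK; have k0 := kappa0.
have mm0 : 0 <= gridM j * (1 - gridM j.+1) by rewrite mulr_ge0 // subr_ge0.
have mm1 : gridM j * (1 - gridM j.+1) <= 1 by rewrite mulr_ile1 //; lra.
have jj : pt j < pt j.+1 by have := ptS j; lra.
have [big|small] := leP theta (gridM j.+1 - gridM j).
  apply: le_trans big; apply: le_trans Keta.
  by apply: ler_piMr => //; apply: mulr_ge0; [exact: mulr_ge0 | exact: ltW].
have [w /andP[jw wj]] := M_mvt f jj; rewrite -/(Mu _ _) -/(Mu _ _) -/(gridM _) -/(gridM _) ptS => ->.
have hN i : N (fun=> w) f i <= (1 / 2) ^+ (64 * K).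
  by have := influence_between i jG (ltW jw) (ltW wj); lra.
have w14 : 1 / 4 <= w <= 3 / 4 by apply/andP; split; lra.
have := kkl mf w14 K0 hN; rewrite -/(Mu _ _).
have jwm : gridM j <= Mu w f by apply: (m_le jG); rewrite ?lexx // ltW.
have wjm : Mu w f <= gridM j.+1 by apply: (m_le jG); rewrite ?lexx // ltW.
have mm : gridM j * (1 - gridM j.+1) <= Mu w f * (1 - Mu w f).
  by apply: ler_pM => //; rewrite ?subr_ge0 // lerD2l lerN2.
have K2 : 0 <= 2 * K%:R :> R by rewrite mulr_ge0.
move=> h; have := ler_wpM2l K2 mm => h2.
rewrite -mulrA [kappa * _]mulrC mulrA [kappa * _]mulrC ler_pM2r //.
by apply: le_trans h2 h.
Qed.

Lemma sharp_threshold : 100 <= (1 + 2 * K%:R * kappa) ^+ ngrid * v ->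
  gridM (ngrid + ngrid) >= 99 / 100 /\ gridM 0%N <= 1 / 100.
Proof.
move=> big; have e0 : 0 <= 2 * K%:R * kappa.
  by apply: mulr_ge0; [exact: mulr_ge0 | exact: ltW].
have vp := v0.
have /andP[v1 v2] := fv; have mG : gridM ngrid = Mu (1 / 2) f.
  by rewrite /gridM -[X in pt X]addn0 ptG mul0r addr0.
(* [odds_growth] wants values in [[0, 1]] at every index, hence the truncation by [minn]. *)
have cl01 k j : 0 <= gridM (minn (k + j) (ngrid + ngrid)) <= 1 by apply: m01; rewrite geq_minr.
have /andP[a0 a1] := m01 (leqnn (ngrid + ngrid)); have /andP[b0 b1] := m01 (leq0n (ngrid + ngrid)).
have big0 : 0 <= (1 + 2 * K%:R * kappa) ^+ ngrid by apply: exprn_ge0; lra.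
split.
  have st j : (j < ngrid)%N -> 2 * K%:R * kappa * (gridM (minn (ngrid + j) (ngrid + ngrid)) *
      (1 - gridM (minn (ngrid + j.+1) (ngrid + ngrid)))) <=
      gridM (minn (ngrid + j.+1) (ngrid + ngrid)) - gridM (minn (ngrid + j) (ngrid + ngrid)).
    move=> jG; have -> : minn (ngrid + j) (ngrid + ngrid) = (ngrid + j)%N.
      by apply/minn_idPl; rewrite leq_add2l ltnW.
    have -> : minn (ngrid + j.+1) (ngrid + ngrid) = (ngrid + j).+1.
      by rewrite addnS; apply/minn_idPl; rewrite ltn_add2l.
    by apply: grid_step; rewrite ltn_add2l.
  have := @odds_growth _ (fun j => gridM (minn (ngrid + j) (ngrid + ngrid))) ngrid e0 (cl01 ngrid) st.
  rewrite /= addn0 minnn (minn_idPl (leq_addr ngrid ngrid)) mG.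
  set X := _ ^+ ngrid in big big0 * => h.
  have h1 : X * (v * (1 - gridM (ngrid + ngrid))) <= X * (Mu (1 / 2) f * (1 - gridM (ngrid + ngrid))).
    by apply: ler_wpM2l => //; apply: ler_wpM2r => //; rewrite subr_ge0.
  have h2 : gridM (ngrid + ngrid) * (1 - Mu (1 / 2) f) <= 1 by rewrite mulr_ile1 //; lra.
  have h3 : 100 * (1 - gridM (ngrid + ngrid)) <= X * v * (1 - gridM (ngrid + ngrid)).
    by apply: ler_wpM2r => //; rewrite subr_ge0.
  lra.
have st j : (j < ngrid)%N -> 2 * K%:R * kappa * (gridM (minn (0 + j) (ngrid + ngrid)) *
    (1 - gridM (minn (0 + j.+1) (ngrid + ngrid)))) <=
    gridM (minn (0 + j.+1) (ngrid + ngrid)) - gridM (minn (0 + j) (ngrid + ngrid)).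
  move=> jG; have jGG : (j < ngrid + ngrid)%N by rewrite (leq_trans jG) ?leq_addr.
  by rewrite !add0n (minn_idPl (ltnW jGG)) (minn_idPl jGG); apply: grid_step.
have := @odds_growth _ (fun j => gridM (minn (0 + j) (ngrid + ngrid))) ngrid e0 (cl01 0%N) st.
rewrite /= !add0n min0n (minn_idPl (leq_addr ngrid ngrid)) mG.
set X := _ ^+ ngrid in big big0 * => h.
have h1 : X * (gridM 0%N * v) <= X * (gridM 0%N * (1 - Mu (1 / 2) f)).
  by apply: ler_wpM2l => //; apply: ler_wpM2l => //; lra.
have h2 : Mu (1 / 2) f * (1 - gridM 0%N) <= 1 by rewrite mulr_ile1 //; lra.
have h3 : 100 * gridM 0%N <= X * v * gridM 0%N by apply: ler_wpM2r.
lra.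
Qed.

(** The mean climbs by at most 1 over the block, so in some cell it climbs by at most
    [1 / L <= theta]. The mean value point of this cell has total influence at most
    [1 / (L * kappa)], which is [4 * Bk / rho]. *)
Lemma test_point (b : nat) : (b < Bk + Bk)%N -> exists w : R,
  [/\ pt (b * L) <= w, w <= pt (b.+1 * L), forall i, N (fun=> w) f i <= 5 * theta &
      \sum_i N (fun=> w) f i <= 4 * Bk%:R / rho].
Proof.
have t0 := theta0; have k0 := kappa0.
move=> bB; have LR : 0 < L%:R :> R by rewrite ltr0n.
have bG j : (j < L)%N -> (b * L + j < ngrid + ngrid)%N.
  move=> jL; apply: (@leq_trans (b.+1 * L)); first by rewrite mulSnr ltn_add2l.
  by rewrite /ngrid mulnC -mulnDr leq_mul2l bB orbT.
have [j hj] : exists j : 'I_L, gridM (b * L + j).+1 - gridM (b * L + j) <= 1 / L%:R.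
  apply/existsP; apply: contraT; rewrite negb_exists => /forallP hall.
  have : \sum_(j < L) (1 / L%:R : R) < \sum_(j < L) (gridM (b * L + j).+1 - gridM (b * L + j)).
    apply: ltr_sum; last by move=> j _; rewrite ltNge hall.
    by apply/hasP; exists (Ordinal L0) => //; rewrite mem_index_enum.
  rewrite sumr_const card_ord -[X in X < _]mulr_natr divfK ?gt_eqF //.
  have tel k : \sum_(j < k) (gridM (b * L + j).+1 - gridM (b * L + j)) = gridM (b * L + k) - gridM (b * L).
    elim: k => [|k IHk]; first by rewrite big_ord0 addn0 subrr.
    by rewrite big_ord_recr /= IHk addnS; ring.
  have bL : (b * L + L <= ngrid + ngrid)%N.
    by rewrite -mulSnr /ngrid [(L * Bk)%N]mulnC -mulnDl leq_mul2r bB orbT.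
  have /andP[_ a1] := m01 bL; have /andP[a0 _] := m01 (leq_trans (leq_addr L _) bL).
  by rewrite tel; lra.
set k := (b * L + j)%N in hj; have kG : (k < ngrid + ngrid)%N by exact: bG.
have jj : pt k < pt k.+1 by have := ptS k; lra.
have [w /andP[kw wk] e] := M_mvt f jj; rewrite -/(Mu _ _) -/(Mu _ _) -/(gridM _) -/(gridM _) ptS in e.
exists w; split.
- by apply: le_trans (ltW kw); apply: pt_le; rewrite leq_addr.
- by apply: le_trans (ltW wk) _; apply: pt_le; rewrite mulSnr /k -addnS leq_add2l.
- move=> i; have := influence_between i kG (ltW kw) (ltW wk).
  have : 1 / L%:R <= theta by rewrite ler_pdivrMr // mulrC.
  lra.
rewrite -(ler_pM2l kappa0) -e; apply: le_trans hj _.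
have -> : kappa * (4 * Bk%:R / rho) = 1 / L%:R; last by [].
rewrite /kappa /ngrid natrM; field.
by rewrite !gt_eqF // ltr0n.
Qed.

(** A bad restriction has mean above 1/4 at live bias 1/4, or below 3/4 at live bias 3/4, or an
    influential coordinate at a test bias. Markov's inequality gives 4/100 for each of the first
    two, and second moments of the influences give 1/100 for the third. *)
Lemma Vbad_good : 100 <= (1 + 2 * K%:R * kappa) ^+ ngrid * v ->
    16 / 9 * d ^+ 2 * (2 * Bk%:R * (4 * Bk%:R / rho)) * (1 / 2) `^ (K%:R * rho) <= 1 / 100 ->
  Vbad rho d f <= 9 / 100.
Proof.
move=> big small; have [hi lo] := sharp_threshold big.
have r0 := rho0; have r1 := rho1; have t0 := theta0; have d00 := d0.
have BR : 0 < Bk%:R :> R by rewrite ltr0n.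
have LR : 0 < L%:R :> R by rewrite ltr0n.
have [w hw] : {w : nat -> R & forall b, (b < Bk + Bk)%N ->
  [/\ pt (b * L) <= w b, w b <= pt (b.+1 * L),
      forall i, N (fun=> w b) f i <= 5 * theta &
      \sum_i N (fun=> w b) f i <= 4 * Bk%:R / rho]}.
  apply: (@choice _ _ (fun b wb => (b < Bk + Bk)%N ->
    [/\ pt (b * L) <= wb, wb <= pt (b.+1 * L),
      forall i, N (fun=> wb) f i <= 5 * theta &
      \sum_i N (fun=> wb) f i <= 4 * Bk%:R / rho])) => b.
  have [bB|bB] := ltnP b (Bk + Bk); last by exists 0.
  by have [x hx] := test_point bB; exists x.
(* The live bias that gives overall bias [w b], dead coordinates being uniform. *)
pose q b := (w b - (1 - rho) / 2) / rho.
have ptq b : (pt (b * L) - (1 - rho) / 2) / rho = 1 / 4 + b%:R / (4 * Bk%:R).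
  by rewrite /pt /kappa /ngrid !natrM; field; rewrite !gt_eqF.
have hq b : (b < Bk + Bk)%N ->
    1 / 4 + b%:R / (4 * Bk%:R) <= q b <= 1 / 4 + b.+1%:R / (4 * Bk%:R).
  move=> /hw[h1 h2 _ _]; rewrite -!ptq /q.
  by apply/andP; split; rewrite ler_pM2r ?invr_gt0 // lerD2r.
have bq b : (b < Bk + Bk)%N -> 1 / 4 <= q b <= 3 / 4.
  move=> bB; have /andP[h1 h2] := hq b bB.
  have h3 : 0 <= b%:R / (4 * Bk%:R) :> R by rewrite divr_ge0 ?mulr_ge0.
  have h4 : b.+1%:R / (4 * Bk%:R) <= 1 / 2 :> R.
    rewrite ler_pdivrMr ?mulr_gt0 //.
    have : b.+1%:R <= (Bk + Bk)%:R :> R by rewrite ler_nat.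
    by rewrite natrD; lra.
  by apply/andP; split; lra.
pose h x : R := (f x)%:R.
have bias_u (u : R) : 0 <= u <= 1 -> bias (fun=> u) (T := T) by move=> ? i.
have brho : bias (fun=> rho) (T := T) by move=> j; rewrite (ltW r0) r1.
(* The inverse square of the influence threshold [3 / (4 d)] of [bad_influential]. *)
pose C : R := 16 / 9 * d ^+ 2.
have C0 : 0 <= C by apply: mulr_ge0; [lra | exact: sqr_ge0].
pose S (B z : cube T) : R :=
  \sum_(b < Bk + Bk) \sum_i Rm (fun=> q b) (diff R f i) B z ^+ 2.
have S0 B z : 0 <= S B z.
  by apply: sumr_ge0 => b _; apply: sumr_ge0 => i _; exact: sqr_ge0.
have pw B z : (`[< bad d f B z >])%:R <=
    4 * (1 - Rm (fun=> 3 / 4) h B z) + 4 * Rm (fun=> 1 / 4) h B z + C * S B z.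
  have CS0 : 0 <= C * S B z by rewrite mulr_ge0.
  have a1 : Rm (fun=> 3 / 4) h B z <= 1.
    by apply: Ex_le1 => [|x]; [apply: bias_u; apply/andP; split; lra|rewrite /h; case: (f _)].
  have a0 : 0 <= Rm (fun=> 1 / 4) h B z.
    by apply: Ex_ge0 => [|x]; [apply: bias_u; apply/andP; split; lra|rewrite /h; case: (f _)].
  case: asboolP => [bd|_] /=; last by lra.
  have [c1|c1] := ltP (Rm (fun=> 3 / 4) h B z) (3 / 4); first by lra.
  have [c2|c2] := ltP (1 / 4) (Rm (fun=> 1 / 4) h B z); first by lra.
  have [b bB [i bi]] := bad_influential mf d0 Bk0 dBk hq bd c2 c1.
  suff : 1 <= C * S B z by lra.
  apply: (@le_trans _ _ (C * (3 / (4 * d)) ^+ 2)).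
    rewrite /C le_eqVlt; apply/orP; left; apply/eqP; field; by rewrite gt_eqF.
  apply: ler_wpM2l => //; rewrite /S (bigD1 (Ordinal bB)) //= (bigD1 i) //=.
  apply: (@le_trans _ _ (Rm (fun=> q b) (diff R f i) B z ^+ 2)).
    by rewrite lerXn2r ?nnegrE ?(le_trans _ bi) // ?divr_ge0 ?mulr_ge0 // ltW.
  rewrite -addrA lerDl addr_ge0 //; first by apply: sumr_ge0 => j _; exact: sqr_ge0.
  by apply: sumr_ge0 => j _; apply: sumr_ge0 => k _; exact: sqr_ge0.
have pmE (u : R) : pm (fun=> rho) (fun=> 1 / 2) (fun=> u) =
    (fun _ : T => (1 - rho) / 2 + rho * u).
  by apply/funext => i; rewrite /pm; field.
have V1 : Vbad rho d f <= 4 * (1 - gridM (ngrid + ngrid)) + 4 * gridM 0%N +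
    C * \sum_(b < Bk + Bk) \sum_i Q (fun=> rho) (fun=> 1 / 2) (fun=> q b) (diff R f i).
  apply: (le_trans (ER_le brho (@bias_half R T) pw)).
  rewrite !ERD !ERZ ERB ER_cst !ER_Rm !pmE ER_sum le_eqVlt; apply/orP; left; apply/eqP.
  have -> : (1 - rho) / 2 + rho * (3 / 4) = pt (ngrid + ngrid) by rewrite ptG Gkappa; field.
  have -> : (1 - rho) / 2 + rho * (1 / 4) = pt 0 by rewrite /pt mul0r; field.
  by congr (_ + C * _); apply: eq_bigr => b _; rewrite ER_sum.
have Qb (b : 'I_(Bk + Bk)) : \sum_i Q (fun=> rho) (fun=> 1 / 2) (fun=> q b) (diff R f i) <=
    4 * Bk%:R / rho * (1 / 2) `^ (K%:R * rho).
  have [_ _ Nw Iw] := hw b (ltn_ord b); have /andP[q1 q2] := bq b (ltn_ord b).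
  have pw' : pm (fun=> rho) (fun=> 1 / 2) (fun=> q b) = (fun _ : T => w b).
    by rewrite pmE; apply/funext => _; rewrite /q; field; rewrite gt_eqF.
  have w14 : 1 / 4 <= w b <= 3 / 4.
    have -> : w b = (1 - rho) / 2 + rho * q b by rewrite /q; field; rewrite gt_eqF.
    by apply/andP; split; nra.
  apply: (@le_trans _ _ ((\sum_i N (fun=> w b) f i) * (1 / 2) `^ (K%:R * rho))); last first.
    by apply: ler_wpM2r => //; exact: powR_ge0.
  rewrite mulr_suml; apply: ler_sum => i _.
  have n0 : 0 <= N (fun=> w b) f i.
    by apply: N_ge0 => // j; have /andP[? ?] := w14; apply/andP; split; lra.
  have := @hypercontractive R T (rho / 64) (fun=> rho) (fun=> 1 / 2) (fun=> q b) (diff R f i).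
  rewrite pw' Ex_diff => hyp.
  apply: (@le_trans _ _ (N (fun=> w b) f i `^ (1 + rho / 64))).
    apply: hyp => //.
    - exact: bias_half.
    - by apply: bias_u; apply/andP; split; lra.
    - by apply/andP; split; lra.
    - move=> _; have hh : 3 / 16 <= q b * (1 - q b) by nra.
      by rewrite -mulrA; have := ler_wpM2l (ltW r0) hh; lra.
    - by move=> x; exact: diff_bound.
  clear hyp; rewrite powRD ?powRr1 //; last by apply/implyP => /eqP; lra.
  apply: ler_wpM2l => //.
  apply: (@le_trans _ _ (((1 / 2 : R) ^+ (64 * K)) `^ (rho / 64))).
    apply: ge0_ler_powR; rewrite ?nnegrE ?exprn_ge0 ?divr_ge0 //; first by rewrite ltW.
    by apply: le_trans thetaK; exact: Nw.
  have -> : (1 / 2 : R) ^+ (64 * K) = (1 / 2) `^ (64 * K)%:R.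
    by rewrite powR_mulrn // divr_ge0.
  rewrite -powRrM; have -> : (64 * K)%:R * (rho / 64) = K%:R * rho.
    by rewrite natrM; field.
  by [].
have sumQ : \sum_(b < Bk + Bk) \sum_i Q (fun=> rho) (fun=> 1 / 2) (fun=> q b) (diff R f i)
    <= 2 * Bk%:R * (4 * Bk%:R / rho * (1 / 2) `^ (K%:R * rho)).
  apply: le_trans (ler_sum _ (fun b _ => Qb b)) _.
  by rewrite sumr_const card_ord -[X in X <= _]mulr_natr natrD le_eqVlt; apply/orP; left; apply/eqP; ring.
have := ler_wpM2l C0 sumQ.
have -> : C * (2 * Bk%:R * (4 * Bk%:R / rho * (1 / 2) `^ (K%:R * rho))) =
  16 / 9 * d ^+ 2 * (2 * Bk%:R * (4 * Bk%:R / rho)) * (1 / 2) `^ (K%:R * rho).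
  by rewrite /C; ring.
move=> CQ; lra.
Qed.

End GoodLeaf.
End Leaf.

(** * Random sets of fixed size *)

Section DownClosed.
Variables (R : realType) (T : finType).
Local Notation n := #|T|.

Definition slice (F : {pred {set T}}) (k : nat) : nat :=
  #|[set A : {set T} | (A \in F) && (#|A| == k)]|.

Lemma card_supersets (B : {set T}) (k : nat) : (#|B| <= k)%N ->
  (#|[set A : {set T} | (B \subset A) && (#|A| == k)]| <= 'C(n - #|B|, k - #|B|))%N.
Proof.
move=> Bk; have -> : (n - #|B|)%N = #|~: B| by rewrite [#|~: B|]cardsCs setCK.
rewrite -(cards_draws (~: B)).
rewrite -(card_in_imset (f := fun A : {set T} => A :\: B)); last first.
  move=> A A'; rewrite !inE => /andP[BA _] /andP[BA' _] e.
  by rewrite -(setID A B) -(setID A' B) e (setIidPr BA) (setIidPr BA').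
apply: subset_leq_card; apply/subsetP => _ /imsetP[A + ->].
rewrite !inE => /andP[BA /eqP Ak]; rewrite setDE subsetIr /=.
by rewrite -setDE cardsD (setIidPr BA) Ak.
Qed.

(** The pairs [B \subset A] of sizes [j] and [k] with [A] in [F] are counted in two ways; each such
    [B] is in [F], and has at most ['C(n - j, k - j)] supersets of size [k]. *)
Lemma slice_double_count (F : {pred {set T}}) (j k : nat) : (j <= k)%N ->
    (forall A B : {set T}, B \subset A -> A \in F -> B \in F) ->
  (slice F k * 'C(k, j) <= slice F j * 'C(n - j, k - j))%N.
Proof.
move=> jk down; rewrite /slice.
have -> : (#|[set A : {set T} | (A \in F) && (#|A| == k)]| * 'C(k, j))%N =
  (\sum_(A : {set T} | (A \in F) && (#|A| == k))
    \sum_(B : {set T} | (B \subset A) && (#|B| == j)) 1)%N.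
  rewrite -sum1_card big_distrl /=; apply: eq_big => [A|A]; first by rewrite inE.
  by rewrite inE => /andP[_ /eqP Ak]; rewrite mul1n sum1_card -Ak -cards_draws; apply: eq_card => B;
    rewrite !inE.
rewrite (exchange_big_dep (fun B : {set T} => (B \in F) && (#|B| == j))) /=; last first.
  by move=> A B /andP[AF _] /andP[BA ->]; rewrite (down _ _ BA AF).
rewrite -[X in (_ <= X * _)%N]sum1_card big_distrl /= [leqRHS](eq_bigl (fun B : {set T} => (B \in F) && (#|B| == j)));
  last by move=> B; rewrite inE.
apply: leq_sum => B /andP[_ /eqP Bj]; rewrite mul1n sum1_card.
rewrite -Bj in jk *; apply: leq_trans (card_supersets jk); apply: subset_leq_card.
by apply/subsetP => A; rewrite !inE => /andP[/andP[_ ->] /andP[-> _]].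
Qed.

Lemma bin_trinomial (m k j : nat) : (j <= k)%N -> (k <= m)%N ->
  ('C(m, k) * 'C(k, j) = 'C(m, j) * 'C(m - j, k - j))%N.
Proof.
move=> jk km; apply/eqP.
rewrite -(eqn_pmul2r (m := j`! * (k - j)`! * (m - k)`!)) ?muln_gt0 ?fact_gt0 //.
have e1 := bin_fact jk; have e2 := bin_fact km.
have e3 := bin_fact (leq_trans jk km); have e4 := bin_fact (leq_sub2r j km).
have e5 : (m - j - (k - j) = m - k)%N by rewrite subnBA // subnK // (leq_trans jk).
rewrite e5 in e4; apply/eqP; transitivity (m`!).
  by rewrite -e2 -e1 -!mulnA.
by rewrite -e3 -e4 -!mulnA; congr (_ * _)%N; rewrite mulnCA.
Qed.

(** Dividing [slice_double_count] by the trinomial identity: the density of a down-closed family in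
    a level does not increase with the level. *)
Lemma slice_antitone (F : {pred {set T}}) (j k : nat) : (j <= k)%N -> (k <= n)%N ->
    (forall A B : {set T}, B \subset A -> A \in F -> B \in F) ->
  (slice F k * 'C(n, j) <= slice F j * 'C(n, k))%N.
Proof.
move=> jk kn down; rewrite -(@leq_pmul2r 'C(k, j)) ?bin_gt0 //.
rewrite -[leqRHS]mulnA bin_trinomial // mulnAC [('C(n, j) * _)%N]mulnC mulnA.
by rewrite leq_mul2r (slice_double_count jk down) orbT.
Qed.

Definition supp (B : cube T) : {set T} := [set i | B i].
Definition indic (A : {set T}) : cube T := [ffun i => i \in A].

Lemma indicK : cancel indic supp.
Proof. by move=> A; apply/setP => i; rewrite inE ffunE. Qed.

Lemma suppK : cancel supp indic.
Proof. by move=> B; apply/ffunP => i; rewrite ffunE inE. Qed.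

Lemma Ex_set (r : R) (h : {set T} -> R) :
  Ex (fun=> r) (fun B => h (supp B)) =
  \sum_(A : {set T}) r ^+ #|A| * (1 - r) ^+ (n - #|A|) * h A.
Proof.
rewrite /Ex (reindex indic); last by exists supp => ? _; [exact: indicK|exact: suppK].
apply: eq_bigr => A _; rewrite indicK; congr (_ * _).
rewrite (bigID (mem A)) /=; congr (_ * _).
  rewrite -prodr_const; apply: eq_bigr => i iA.
  by rewrite /bw ffunE iA.
have -> : (n - #|A|)%N = #|~: A| by rewrite [#|~: A|]cardsCs setCK.
rewrite -prodr_const; apply: eq_big => [i|i /negPf iA]; first by rewrite inE.
by rewrite /bw ffunE iA.
Qed.

Lemma Ex_coord (r : R) i : Ex (fun=> r) (fun B : cube T => (B i)%:R) = r.
Proof.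
rewrite (Ex_split i).
have e b : sub (fun B : cube T => (B i)%:R : R) i b = fun=> b%:R.
  by apply/funext => x; rewrite /sub upd_eq.
by rewrite !e !Ex_cst mulr1 mulr0 addr0.
Qed.

(* By Markov's inequality the random set has at most [k] elements with
   probability at least 1/2, and smaller slices of [F] are denser. *)
Lemma slice_le_Ex (F : {pred {set T}}) (k : nat) : (0 < k)%N -> (k <= n)%N ->
    (forall A B : {set T}, B \subset A -> A \in F -> B \in F) ->
  (slice F k)%:R / 'C(n, k)%:R <=
    2 * Ex (fun=> k%:R / (2 * n%:R) : R) (fun B => (supp B \in F)%:R).
Proof.
move=> k0 kn down; set r : R := k%:R / (2 * n%:R).
have kR : 0 < k%:R :> R by rewrite ltr0n.
have nR : 0 < n%:R :> R by rewrite ltr0n (leq_trans k0).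
have knR : k%:R <= n%:R :> R by rewrite ler_nat.
have r0 : 0 <= r by rewrite divr_ge0 ?mulr_ge0 // ltW.
have r1 : r <= 1 by rewrite ler_pdivrMr ?mulr_gt0 //; lra.
have br : bias (fun=> r) (T := T) by move=> i; rewrite r0 r1.
have cR : 0 < 'C(n, k)%:R :> R by rewrite ltr0n bin_gt0.
set phi : R := (slice F k)%:R / 'C(n, k)%:R.
have phi0 : 0 <= phi by rewrite divr_ge0.
pose w (j : nat) : R := r ^+ j * (1 - r) ^+ (n - j).
have w0 j : 0 <= w j by rewrite mulr_ge0 ?exprn_ge0 // subr_ge0.
have small : 1 / 2 <= Ex (fun=> r) (fun B => (#|supp B| <= k)%N%:R).
  (* Markov's inequality: [1 - #|B| / k] is a lower bound for the indicator, with mean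
     [1 - n r / k = 1/2]. *)
  have : Ex (fun=> r) (fun B : cube T => 1 - k%:R^-1 * \sum_i (B i)%:R) <=
      Ex (fun=> r) (fun B => (#|supp B| <= k)%N%:R).
    apply: Ex_le => // B.
    have -> : \sum_i (B i)%:R = #|supp B|%:R :> R.
      rewrite -sum1_card natr_sum big_mkcond [RHS]big_mkcond /=; apply: eq_bigr => i _.
      by rewrite inE; case: (B i).
    have [_|kB] := leqP #|supp B| k.
      by rewrite gerBl mulr_ge0 // invr_ge0 ltW.
    rewrite mulrC subr_le0 ler_pdivlMr // mul1r ler_nat; exact: ltnW.
  rewrite ExB Ex_cst ExZ Ex_sum.
  under eq_bigr do rewrite Ex_coord.
  have -> : \sum_(i : T) r = n%:R * r by rewrite sumr_const mulr_natl.
  have -> : 1 - k%:R^-1 * (n%:R * r) = 1 / 2.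
    by rewrite /r; field; rewrite !gt_eqF.
  by [].
have key : phi * Ex (fun=> r) (fun B => (#|supp B| <= k)%N%:R) <=
    Ex (fun=> r) (fun B => (supp B \in F)%:R).
  rewrite (Ex_set r (fun A => (#|A| <= k)%N%:R)) (Ex_set r (fun A => (A \in F)%:R)).
  apply: (@le_trans _ _ (\sum_(A : {set T} | (#|A| <= k)%N) w #|A| * (A \in F)%:R)); last first.
    rewrite big_mkcond /=; apply: ler_sum => A _; case: ifP => // _.
    by apply: mulr_ge0 => //; exact: w0.
  rewrite mulr_sumr (bigID (fun A : {set T} => (#|A| <= k)%N)) /= [X in _ + X]big1 ?addr0; last first.
    by move=> A /negPf ->; rewrite !mulr0.
  rewrite [leLHS](partition_big (fun A : {set T} => inord #|A| : 'I_k.+1) predT) //=.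
  rewrite [leRHS](partition_big (fun A : {set T} => inord #|A| : 'I_k.+1) predT) //=.
  apply: ler_sum => j _.
  have jk : (j <= k)%N by rewrite -ltnS.
  have eqj (A : {set T}) : ((#|A| <= k)%N && (inord #|A| == j :> 'I_k.+1)) = (#|A| == j).
    apply/andP/idP => [[Ak /eqP <-]|/eqP e]; first by rewrite inordK ?ltnS.
    by rewrite e jk; split=> //; apply/eqP/val_inj; rewrite /= inordK.
  rewrite !(eq_bigl (fun A : {set T} => #|A| == j) _ eqj).
  have -> : \sum_(A : {set T} | #|A| == j) phi * (r ^+ #|A| * (1 - r) ^+ (n - #|A|) *
      (#|A| <= k)%N%:R) = phi * w j * 'C(n, j)%:R.
    rewrite -card_draws -sum1_card natr_sum mulr_sumr; apply: eq_big => [A|A /eqP ->].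
      by rewrite inE.
    by rewrite jk mulr1 mulr1.
  have -> : \sum_(A : {set T} | #|A| == j) w #|A| * (A \in F)%:R = w j * (slice F j)%:R.
    rewrite /slice -sum1_card natr_sum mulr_sumr [RHS]big_mkcond [LHS]big_mkcond /=.
    apply: eq_bigr => A _; rewrite inE andbC; case: eqP => [->|] //=.
    by case: (A \in F); rewrite ?mulr1 ?mulr0.
  rewrite [phi * w j]mulrC -mulrA; apply: ler_wpM2l => //.
  rewrite /phi mulrAC ler_pdivrMr // -!natrM ler_nat.
  exact: slice_antitone.
have := ler_wpM2l phi0 small; lra.
Qed.

End DownClosed.

(** * Fourier influences and restricted functions *)

Section Link.
Variables (R : realType) (T : finType).
Implicit Types (f : cube T -> bool).

Lemma card_cubeR : #|{: cube T}|%:R = \prod_(i : T) 2 :> R.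
Proof. by rewrite card_ffun card_bool natrX prodr_const. Qed.

Lemma card_cube_gt0 : 0 < #|{: cube T}|%:R :> R.
Proof. by rewrite card_cubeR; apply: prodr_gt0 => i _. Qed.

Lemma Ex_half (h : cube T -> R) : Ex (fun=> 1 / 2) h = mean h.
Proof.
rewrite /mean mulr_suml; apply: eq_bigr => x _; rewrite mulrC; congr (_ * _).
rewrite card_cubeR -prodfV; apply: eq_bigr => i _.
by rewrite /bw; case: (x i); rewrite mul1r //; field.
Qed.

Lemma influence_kernel (i : T) (x y : cube T) :
  \sum_(S : {set T} | i \in S) chi R S x * chi R S y =
  \prod_j (sgn R (x j) * sgn R (y j) + (j != i)%:R).
Proof.
rewrite bigA_distr big_mkcond; apply: eq_bigr => S _.
case: ifP => iS.
  rewrite /chi -big_split /= big_mkcond; apply: eq_bigr => j _.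
  by case: ifP => // jS; case: eqP => // ji; rewrite ji iS in jS.
by rewrite (bigD1 i) //= iS eqxx mul0r.
Qed.

(** The Fourier sum becomes a double sum over [x] and [y] whose kernel vanishes unless they agree
    outside [i]; what remains is a quarter of the mean of the square of [diff f i], and by
    monotonicity [diff f i] equals its square. *)
Lemma Inf_N f i : monotone f -> N (fun=> 1 / 2) f i = 4 * Inf R f i.
Proof.
move=> mf; pose c : R := #|{: cube T}|%:R; have c0 : 0 < c by exact: card_cube_gt0.
pose h x : R := (f x)%:R.
pose K (x y : cube T) : R := \prod_j (sgn R (x j) * sgn R (y j) + (j != i)%:R).
pose P : R := \prod_(j : T | j != i) 2.
have cP : c = 2 * P by rewrite /c card_cubeR (bigD1 i).
have I1 : Inf R f i = c^-2 * \sum_x \sum_y h x * h y * K x y.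
  rewrite /Inf /fourier /mean -/c.
  transitivity (\sum_(S : {set T} | i \in S)
      c^-2 * \sum_x \sum_y h x * h y * (chi R S x * chi R S y)).
    apply: eq_bigr => S _; rewrite exprMn exprVn mulrC; congr (_ * _).
    rewrite expr2 mulr_suml; apply: eq_bigr => x _; rewrite mulr_sumr.
    by apply: eq_bigr => y _; rewrite /h; ring.
  rewrite -mulr_sumr exchange_big /=; congr (_ * _); apply: eq_bigr => x _.
  rewrite exchange_big /=; apply: eq_bigr => y _.
  by rewrite -mulr_sumr influence_kernel.
have K1 x b : K x (upd x i b) = sgn R (x i) * sgn R b * P.
  rewrite /K (bigD1 i) //= upd_eq eqxx addr0; congr (_ * _).
  apply: eq_bigr => j ji; rewrite ffunE (negPf ji) /=.
  by rewrite /sgn; case: (x j); rewrite ?mulrNN mulr1.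
have K0 x y : y != upd x i true -> y != upd x i false -> K x y = 0.
  move=> y1 y0; have [j yj] : exists j, y j != upd x i (y i) j.
    apply/existsP; apply: contraT; rewrite negb_exists => /forallP H.
    have e : y = upd x i (y i) by apply/ffunP => j; apply/eqP; rewrite -[_ == _]negbK H.
    by move: y1 y0; rewrite e; case: (y i); rewrite eqxx.
  have ji : j != i by apply: contraNneq yj => ->; rewrite upd_eq.
  rewrite /K (bigD1 j) //= ji; move: yj; rewrite ffunE (negPf ji) /sgn.
  by case: (y j) (x j) => [] [] // _; rewrite ?mul1r ?mulr1 addNr mul0r.
have I2 x : \sum_y h x * h y * K x y = P * (h x * sgn R (x i) * diff R f i x).
  rewrite (bigD1 (upd x i true)) //= (bigD1 (upd x i false)) /=; last first.
    by apply/eqP => /(congr1 (fun u : cube T => u i)); rewrite !upd_eq.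
  rewrite big1 ?addr0; last by move=> y /andP[? ?]; rewrite K0 ?mulr0.
  by rewrite !K1 /diff /sub /h /sgn /=; ring.
have S2 : \sum_x h x * sgn R (x i) * diff R f i x =
    c * Ex (fun=> 1 / 2) (fun x => h x * sgn R (x i) * diff R f i x).
  by rewrite Ex_half /mean -/c mulrCA divff ?mulr1 // gt_eqF.
have e b : sub (fun x => h x * sgn R (x i) * diff R f i x) i b =
    fun x => sgn R b * ((sub f i b x)%:R * diff R f i x).
  apply/funext => x; rewrite /sub upd_eq /h /diff /sub !upd_upd.
  by ring.
have S3 : Ex (fun=> 1 / 2) (fun x => h x * sgn R (x i) * diff R f i x) =
    N (fun=> 1 / 2) f i / 2.
  rewrite (Ex_split i) !e !ExZ /sgn.
  have <- : Ex (fun=> 1 / 2) (fun x => (sub f i true x)%:R * diff R f i x) -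
      Ex (fun=> 1 / 2) (fun x => (sub f i false x)%:R * diff R f i x) =
      N (fun=> 1 / 2) f i.
    rewrite -Ex_diff -ExB; apply: eq_Ex => x.
    have := diff_bound R i x mf; rewrite /diff.
    by case: (sub f i true x) (sub f i false x) => [] [] /=; lra.
  by field.
rewrite I1; under eq_bigr do rewrite I2.
rewrite -mulr_sumr S2 S3 cP; field.
by rewrite gt_eqF //; move: c0; rewrite cP; lra.
Qed.

Lemma N_le_MaxInf f i : monotone f -> N (fun=> 1 / 2) f i <= 4 * MaxInf R f.
Proof.
by move=> mf; rewrite Inf_N // ler_pM2l // /MaxInf; apply: le_bigmax.
Qed.

Lemma Var_M f : Var R f = M (fun=> 1 / 2) f * (1 - M (fun=> 1 / 2) f).
Proof.
rewrite /Var -!Ex_half -/(M _ f); set u := M _ f.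
have -> : u * (1 - u) = u - 2 * u * u + u ^+ 2 by ring.
rewrite -[X in _ = _ + X](Ex_cst (fun=> 1 / 2 : R) (T := T)) /u {3}/M.
rewrite -{1}/(M (fun=> 1 / 2) f) -/u.
transitivity (Ex (fun=> 1 / 2) (fun x => (f x)%:R - 2 * u * (f x)%:R + u ^+ 2)).
  by apply: eq_Ex => x; case: (f x) => /=; ring.
by rewrite ExD ExB ExZ !Ex_cst.
Qed.

(* Answers the queries outside [B] according to [z]. *)
Fixpoint fix_outside (B z : cube T) (t : dtree T) : dtree T :=
  match t with
  | Leaf c => Leaf c
  | Query j t0 t1 =>
      if B j then Query j (fix_outside B z t0) (fix_outside B z t1)
      else if z j then fix_outside B z t1 else fix_outside B z t0
  end.

Lemma depth_fix_outside B z t : (depth (fix_outside B z t) <= depth t)%N.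
Proof.
elim: t => [c //|j t0 IH0 t1 IH1] /=; case: (B j).
  by rewrite /= ltnS geq_max !leq_max IH0 IH1 orbT.
by case: (z j); apply: leqW; rewrite leq_max ?IH0 ?IH1 ?orbT.
Qed.

Lemma dt_eval_fix_outside B z t y : dt_eval (fix_outside B z t) y = dt_eval t (mix B y z).
Proof.
elim: t => [c //|j t0 IH0 t1 IH1] /=; rewrite ffunE; case: (B j) => /=.
  by rewrite IH0 IH1.
by case: (z j).
Qed.

(** A tree for the live set [A] serves for [B] once its queries outside [B] are answered by [z]. So
    for fixed [z] the bad live sets form a down-closed family, as [slice_le_Ex] requires. *)
Lemma bad_subset (d : R) f (A B : {set T}) z :
  B \subset A -> bad d f (indic A) z -> bad d f (indic B) z.
Proof.
move=> /subsetP BA [t td et]; exists (fix_outside (indic B) z t).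
  by apply: le_lt_trans td; rewrite ler_nat depth_fix_outside.
move=> y; rewrite dt_eval_fix_outside et; congr f; apply/ffunP => i; rewrite !ffunE.
by case: (boolP (i \in B)) => [/BA -> //|_]; rewrite if_same.
Qed.

Fixpoint dtree_val (A : {set T}) (t : dtree {i : T | i \in A}) : dtree T :=
  match t with
  | Leaf c => Leaf c
  | Query j t0 t1 => Query (val j) (dtree_val t0) (dtree_val t1)
  end.

Lemma DT_bad (d : R) f (A : {set T}) z :
  (DT (restrict f A z))%:R < d -> bad d f (indic A) z.
Proof.
rewrite /DT; case: ex_minnP => m /asboolP[t [et dt]] _ md.
exists (dtree_val t).
  have -> // : depth (dtree_val t) = m.
  by rewrite -dt; elim: t {et dt} => //= j t0 -> t1 ->.
move=> y; transitivity (dt_eval t [ffun a => y (val a)]).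
  by elim: t {et dt} => //= j t0 -> t1 ->; rewrite ffunE.
rewrite et /restrict; congr f; apply/ffunP => i; rewrite !ffunE.
by case: insubP => [a -> <-|/negPf ->]; rewrite ?ffunE.
Qed.

Lemma Ex_swap (p q : T -> R) (h : cube T -> cube T -> R) :
  Ex p (fun x => Ex q (fun y => h x y)) = Ex q (fun y => Ex p (fun x => h x y)).
Proof.
rewrite /Ex; under eq_bigr do rewrite mulr_sumr.
rewrite exchange_big /=; apply: eq_bigr => y _; rewrite mulr_sumr.
by apply: eq_bigr => x _; rewrite mulrCA.
Qed.

(** For each [z] the failing sets lie in one level of a down-closed family, so [slice_le_Ex]
    replaces them by independent live coordinates at the price of a factor 2. *)
Lemma prob_DT_ge (d : R) f (k : nat) : (0 < k)%N -> (k <= #|T|)%N ->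
  1 - 2 * Vbad (k%:R / (2 * #|T|%:R)) d f <=
  prob R (restrictions T k) (fun Az => d <= (DT (restrict f Az.1 Az.2))%:R).
Proof.
move=> k0 kn; set r : R := k%:R / _.
pose c : R := #|{: cube T}|%:R; have c0 : 0 < c by exact: card_cube_gt0.
have C0 : 0 < 'C(#|T|, k)%:R :> R by rewrite ltr0n bin_gt0.
pose F z : {pred {set T}} := [pred A | `[< bad d f (indic A) z >]].
have omega : #|restrictions T k| = ('C(#|T|, k) * #|{: cube T}|)%N.
  rewrite -card_draws -cardsT -cardsX; apply: eq_card => -[A z].
  by rewrite !inE andbT.
pose E (Az : {set T} * cube T) := d <= (DT (restrict f Az.1 Az.2))%:R.
have split : (#|restrictions T k| <= #|[set u in restrictions T k | E u]| +
    \sum_(z : cube T) slice (F z) k)%N.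
  have -> : (\sum_(z : cube T) slice (F z) k)%N =
      #|[set u : {set T} * cube T | (u.1 \in F u.2) && (#|u.1| == k)]|.
    rewrite -sum1_card (eq_bigl (fun u : {set T} * cube T =>
      true && ((u.1 \in F u.2) && (#|u.1| == k)))); last by move=> u; rewrite !inE.
    rewrite (partition_big snd predT) //=; apply: eq_bigr => z _.
    rewrite /slice -sum1_card (reindex_onto (fun A => (A, z)) fst) /=.
      by apply: eq_bigl => A; rewrite !inE ?eqxx /= !andbT.
    by move=> [A z'] /= /andP[_ /eqP ->].
  apply: leq_trans (leq_card_setU _ _); apply: subset_leq_card; apply/subsetP => -[A z].
  rewrite !inE /= => Ak; rewrite Ak !andbT /=.
  apply/orP; have [h|lt] := leP d (DT (restrict f A z))%:R; [by left | right].
  by apply/asboolP; exact: DT_bad.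
have sl : (\sum_(z : cube T) slice (F z) k)%:R <= 2 * Vbad r d f * (c * 'C(#|T|, k)%:R).
  have -> : 2 * Vbad r d f * (c * 'C(#|T|, k)%:R) = \sum_(z : cube T)
     2 * Ex (fun=> r) (fun B => (supp B \in F z)%:R) * 'C(#|T|, k)%:R.
    rewrite -mulr_suml -mulr_sumr mulrA; congr (_ * _).
    rewrite -mulrA; congr (_ * _); rewrite /Vbad /ER Ex_swap Ex_half /mean -/c divfK ?gt_eqF //.
    by apply: eq_bigr => z _; apply: eq_Ex => B; rewrite inE suppK.
  rewrite natr_sum; apply: ler_sum => z _.
  rewrite -ler_pdivrMr //; apply: slice_le_Ex => // A B BA; rewrite !inE.
  by move=> /asboolP ?; apply/asboolP; apply: bad_subset BA _.
rewrite /prob -/E omega natrM -/c ler_pdivlMr ?mulr_gt0 //.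
move: split; rewrite -(ler_nat R) omega natrD natrM -/c => split.
rewrite -[X in _ <= X]/(#|[set u in restrictions T k | E u]|%:R : R); lra.
Qed.

End Link.

(** * Choice of the parameters *)

Section Numerics.
Variable R : realType.

Lemma expR_ge_id (x : R) : x <= expR x.
Proof. by have := expR_ge1Dx x; lra. Qed.

Lemma pow2_le_expR (n : nat) : 2 ^+ n <= expR n%:R :> R.
Proof.
rewrite -[n%:R]mulr1 expRM_natl lerXn2r ?nnegrE ?expR_ge0 //.
by have := expR_ge1Dx (1 : R); lra.
Qed.

Lemma half_powR_le (x : R) : 0 <= x -> (1 / 2) `^ x <= expR (- (x / 2)).
Proof.
move=> x0; rewrite /powR ifF ?ler_expR; last by apply/eqP; lra.
have : ln (1 + - (1 / 2)) <= - (1 / 2) :> R by apply: le_ln1Dx; lra.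
have -> : 1 + - (1 / 2) = 1 / 2 :> R by field.
by move=> h; have := ler_wpM2l x0 h; lra.
Qed.

(** [exp(eta / 2) <= 1 / (1 - eta / 2) <= 1 + eta], as [eta <= 1]. *)
Lemma expR_le_pow (eta : R) (n : nat) : 0 <= eta <= 1 ->
  expR (n%:R * (eta / 2)) <= (1 + eta) ^+ n.
Proof.
move=> /andP[e0 e1]; rewrite expRM_natl lerXn2r ?nnegrE ?expR_ge0 //; first by lra.
have h := expR_ge1Dx (- (eta / 2)); rewrite expRN in h.
have p := expR_gt0 (eta / 2); set y := expR _ in h p *.
have h1 : (1 - eta / 2) * y <= 1.
  have : (1 - eta / 2) * y <= y^-1 * y by apply: ler_wpM2r; [exact: ltW|lra].
  by rewrite mulVf ?gt_eqF.
have [//|yl] := leP y (1 + eta).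
have : 0 < (y - (1 + eta)) * (1 - eta / 2) by rewrite mulr_gt0 //; lra.
have : 0 <= eta * (1 - eta) by rewrite mulr_ge0 //; lra.
lra.
Qed.

Lemma tail_linear (X : R) : 10 ^+ 14 <= X ->
  256 * X * expR (- (X / (2 * 10 ^+ 4))) <= 1 / 100.
Proof.
move=> hX; have X0 : 0 < X by lra.
rewrite expRN ler_pdivrMr ?expR_gt0 //.
have -> : X / (2 * 10 ^+ 4) = X / (4 * 10 ^+ 4) + X / (4 * 10 ^+ 4) by field.
rewrite expRD; have h := expR_ge_id (X / (4 * 10 ^+ 4)).
have h0 : 0 <= X / (4 * 10 ^+ 4) by lra.
have := ler_pM h0 h0 h h; set Y := expR _ * _ => hY.
have : 10 ^+ 14 * X <= X * X by apply: ler_wpM2r => //; exact: ltW.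
lra.
Qed.

Lemma tail_cubic (E : R) : 10 ^+ 6 <= E ->
  3 / 2 * E ^+ 3 * expR (- (E / 2)) <= 1 / 20.
Proof.
move=> hE; have E0 : 0 < E by lra.
rewrite expRN ler_pdivrMr ?expR_gt0 //.
have -> : E / 2 = 4%:R * (E / 8) by field.
rewrite expRM_natl; have h := expR_ge_id (E / 8).
have : (E / 8) ^+ 4 <= expR (E / 8) ^+ 4 by rewrite lerXn2r ?nnegrE ?expR_ge0 //; lra.
set Y := expR _ ^+ 4 => hY.
have : 10 ^+ 6 * E ^+ 3 <= E * E ^+ 3 by apply: ler_wpM2r => //; rewrite exprn_ge0 // ltW.
have e4 : (E / 8) ^+ 4 = E * E ^+ 3 / (64 * 64) by field.
rewrite e4 in hY.
have : 0 <= E ^+ 3 by rewrite exprn_ge0 // ltW.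
lra.
Qed.

(** [X] stands for [rho * E] in [Vbad_le]. The powers of [d] and [Bk] amount to a constant times
    [d^4 = exp(4 X / 10^5)], which the hypercontractive gain [exp(- X / 8000)] dominates. *)
Lemma test_bound (X rho' d : R) (K Bk : nat) :
    10 ^+ 14 <= X -> 0 < rho' -> 1 / rho' <= 2 * X -> d = expR (X / 10 ^+ 5) ->
    Bk%:R <= 3 * d -> X / (4 * 10 ^+ 3) <= K%:R * rho' ->
  16 / 9 * d ^+ 2 * (2 * Bk%:R * (4 * Bk%:R / rho')) * (1 / 2) `^ (K%:R * rho')
    <= 1 / 100.
Proof.
move=> X14 r'0 r'X dE B3 Kr; have X0 : 0 < X by lra.
have d0 : 0 < d by rewrite dE expR_gt0.
have h1 : (1 / 2) `^ (K%:R * rho') <= expR (- (X / (8 * 10 ^+ 3))).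
  apply: le_trans (half_powR_le _) _; first by rewrite mulr_ge0 // ltW.
  by rewrite ler_expR; lra.
have h2 : Bk%:R * Bk%:R <= 9 * d ^+ 2.
  have -> : 9 * d ^+ 2 = (3 * d) * (3 * d) by ring.
  by apply: ler_pM.
have d4 : d ^+ 4 = expR (4%:R * (X / 10 ^+ 5)) by rewrite expRM_natl dE.
have d20 : 0 <= d ^+ 2 by rewrite exprn_ge0 // ltW.
have ir0 : 0 <= 1 / rho' by rewrite divr_ge0 // ltW.
apply: le_trans (tail_linear X14).
apply: (@le_trans _ _ (128 * d ^+ 4 * (1 / rho') * expR (- (X / (8 * 10 ^+ 3))))).
  have -> : 16 / 9 * d ^+ 2 * (2 * Bk%:R * (4 * Bk%:R / rho')) =
    128 / 9 * (d ^+ 2 * (Bk%:R * Bk%:R)) * (1 / rho') by field; rewrite gt_eqF.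
  have -> : 128 * d ^+ 4 * (1 / rho') = 128 / 9 * (d ^+ 2 * (9 * d ^+ 2)) * (1 / rho').
    by field; rewrite gt_eqF.
  apply: ler_pM h1; last 1 first.
  - apply: ler_wpM2r => //; apply: ler_wpM2l; first by rewrite divr_ge0.
    exact: ler_wpM2l.
  - apply: mulr_ge0 => //; apply: mulr_ge0; first by lra.
    by apply: mulr_ge0 => //; exact: mulr_ge0.
  - exact: powR_ge0.
rewrite d4; set a := expR (4%:R * _).
apply: (@le_trans _ _ (128 * a * (2 * X) * expR (- (X / (8 * 10 ^+ 3))))).
  apply: ler_wpM2r; first exact: expR_ge0.
  by apply: ler_wpM2l => //; rewrite mulr_ge0 // expR_ge0.
have -> : 128 * a * (2 * X) * expR (- (X / (8 * 10 ^+ 3))) =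
  256 * X * (a * expR (- (X / (8 * 10 ^+ 3)))) by ring.
rewrite /a -expRD; apply: ler_wpM2l; first by rewrite mulr_ge0 // ltW.
by rewrite ler_expR; lra.
Qed.

(** The power is at least [exp(x / 4)], and [x / 4 - Lv >= 8], so the product is at least
    [2^8 / 2 = 128]. *)
Lemma odds_bound (x eta Lv : R) (n : nat) :
    0 <= eta <= 1 -> 1 <= Lv -> n%:R * (eta / 2) = x / 4 -> 36 * Lv <= x ->
  100 <= (1 + eta) ^+ n * (expR (- Lv) / 2).
Proof.
move=> e01 Lv1 e hx; have := expR_le_pow n e01; rewrite e => h.
have v0 : 0 <= expR (- Lv) / 2 by rewrite divr_ge0 ?expR_ge0.
apply: le_trans (ler_wpM2r v0 h); rewrite mulrA -expRD.
have h8 : 8%:R <= x / 4 + - Lv by lra.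
rewrite -ler_expR in h8; have := pow2_le_expR 8; lra.
Qed.

(** [theta] makes [5 * theta] exactly the KKL threshold, and [L] makes [L * theta] equal to [K], so
    that [2 K kappa] becomes [rho * theta / (2 * Bk)]. *)
Lemma grid_parameters (K : nat) : (0 < K)%N -> exists (L : nat) (theta : R),
  [/\ (0 < L)%N, 0 < theta, theta <= 1, L%:R * theta = K%:R &
      5 * theta = (1 / 2) ^+ (64 * K) /\ theta^-1 ^+ 3 = 125 * 2 ^+ (192 * K)].
Proof.
move=> K0; exists (K * (5 * 2 ^ (64 * K)))%N, ((1 / 2) ^+ (64 * K) / 5).
have t0 : 0 < (2 : R) ^+ (64 * K) by rewrite exprn_gt0.
have -> : (192 * K = (64 * K) * 3)%N by rewrite mulnAC.
rewrite [2 ^+ (64 * K * 3)]exprM !natrM natrX expr_div_n expr1n muln_gt0 K0 muln_gt0 expn_gt0 /=.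
have : (1 : R) <= 2 ^+ (64 * K) by rewrite exprn_ege1 // ler1n.
move: (2 ^+ (64 * K)) t0 => y y0 y1; split=> //.
- by apply: divr_gt0 => //; exact: divr_gt0.
- by rewrite ler_pdivrMr // ler_pdivrMr //; lra.
- by field; rewrite gt_eqF.
by split; field; rewrite gt_eqF.
Qed.

(** The dominant factor of [W] is [theta^-3], of order [2^(192 K)] with [192 = 3 * 64]. As
    [K <= E / 1000], this is at most of order [exp(0.192 E)], and the total exponent stays below
    [- E / 2]. *)
Lemma cost_bound (E X Lv d r theta W : R) (K Bk : nat) :
    10 ^+ 6 <= E -> X <= E -> 0 <= r -> r <= 2 * X -> d = expR (X / 10 ^+ 5) -> 0 < d ->
    0 < theta -> Bk%:R <= 3 * d -> K%:R <= E / 10 ^+ 3 ->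
    theta^-1 ^+ 3 = 125 * 2 ^+ (192 * K) ->
    W = 80 * K%:R ^+ 2 * Bk%:R ^+ 2 * r * theta^-1 ^+ 3 -> 10 ^+ 6 * Lv <= E ->
  8 * W * (expR (- E) * expR Lv) <= 1 / 20.
Proof.
move=> E1 XE r0 rX dE d0 t0 B3 KE t3 WE LE; have E0 : 0 < E by lra.
have th3 : theta^-1 ^+ 3 <= 125 * expR (192 / 10 ^+ 3 * E).
  rewrite t3 ler_pM2l //; apply: le_trans (pow2_le_expR _) _.
  by rewrite ler_expR natrM; lra.
have d2 : d ^+ 2 = expR (2%:R * (X / 10 ^+ 5)) by rewrite expRM_natl dE.
have h2 : Bk%:R ^+ 2 <= 9 * d ^+ 2.
  have -> : 9 * d ^+ 2 = (3 * d) ^+ 2 by ring.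
  by rewrite lerXn2r ?nnegrE // ltW // mulr_gt0.
have hK : K%:R ^+ 2 <= (E / 10 ^+ 3) ^+ 2.
  by rewrite lerXn2r ?nnegrE // divr_ge0 ?exprn_ge0 // ltW.
have K20 : 0 <= K%:R ^+ 2 :> R by rewrite exprn_ge0.
have B20 : 0 <= Bk%:R ^+ 2 :> R by rewrite exprn_ge0.
have h1 : 80 * K%:R ^+ 2 <= 80 * (E / 10 ^+ 3) ^+ 2 by rewrite ler_pM2l.
have Wle : W <= 80 * (E / 10 ^+ 3) ^+ 2 * (9 * d ^+ 2) * (2 * E) *
    (125 * expR (192 / 10 ^+ 3 * E)).
  rewrite WE; apply: ler_pM th3.
  - by rewrite !mulr_ge0.
  - by rewrite exprn_ge0 // invr_ge0 ltW.
  apply: ler_pM => //.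
  - by rewrite !mulr_ge0.
  - by apply: ler_pM => //; rewrite mulr_ge0.
  - by lra.
have EL0 : 0 <= expR (- E) * expR Lv by rewrite mulr_ge0 ?expR_ge0.
apply: le_trans (tail_cubic E1).
apply: (@le_trans _ _ (8 * (80 * (E / 10 ^+ 3) ^+ 2 * (9 * d ^+ 2) * (2 * E) *
   (125 * expR (192 / 10 ^+ 3 * E))) * (expR (- E) * expR Lv))).
  by apply: ler_wpM2r => //; rewrite ler_pM2l.
rewrite d2; set a := expR (2%:R * _); set b := expR (192 / 10 ^+ 3 * E).
have -> : 8 * (80 * (E / 10 ^+ 3) ^+ 2 * (9 * a) * (2 * E) * (125 * b)) *
   (expR (- E) * expR Lv) = 36 / 25 * E ^+ 3 * (a * b * expR (- E) * expR Lv) by field.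
have E30 : 0 <= E ^+ 3 by rewrite exprn_ge0 // ltW.
rewrite /a /b -!expRD; apply: ler_pM; rewrite ?expR_ge0 //.
- by rewrite mulr_ge0 // divr_ge0.
- by apply: ler_wpM2r => //; lra.
by rewrite ler_expR; lra.
Qed.

End Numerics.

(** * Assembling the estimates *)

Section Assembly.
Variables (R : realType) (T : finType).
Implicit Types (f : cube T -> bool).

Lemma Vbad_bound f (rho d theta v u : R) (L Bk K l : nat) :
    0 < rho -> rho <= 1 -> 0 < d -> (0 < L)%N -> (0 < Bk)%N -> (0 < K)%N -> (0 < l)%N ->
    0 < theta -> 1 <= L%:R * theta -> 5 * theta <= (1 / 2) ^+ (64 * K) ->
    2 * d <= Bk%:R -> 2 * K%:R * kappa rho L Bk <= theta ->
    100 <= (1 + 2 * K%:R * kappa rho L Bk) ^+ ngrid L Bk * v ->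
    16 / 9 * d ^+ 2 * (2 * Bk%:R * (4 * Bk%:R / rho)) * (1 / 2) `^ (K%:R * rho)
      <= 1 / 100 ->
    0 < v -> monotone f -> 2 * v <= M (fun=> 1 / 2) f <= 1 - 2 * v ->
    0 <= u -> (forall i, N (fun=> 1 / 2) f i <= u) ->
  Vbad rho d f <= 9 / 100 + l%:R * u / (2 * v) +
    (ngrid L Bk)%:R / (l%:R * (kappa rho L Bk * theta)).
Proof.
move=> r0 r1 d0 L0 Bk0 K0 l0 t0 Lt tK dB Ke big small v0 mf fv u0 hu.
have k0 : 0 < kappa rho L Bk.
  by rewrite /kappa divr_gt0 ?mulr_gt0 // ltr0n /ngrid muln_gt0 L0.
have kt0 : 0 < kappa rho L Bk * theta by rewrite mulr_gt0.
have r01 : 0 <= rho <= 1 by rewrite (ltW r0).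
have c0 : 0 <= 9 / 100 :> R by lra.
have l0' : 0 < l%:R :> R by rewrite ltr0n.
apply: le_trans (@reveal_bound R T rho d r01 (@grid_small R T rho theta L Bk)
  (@potential R T rho L Bk) _ v _ u l f kt0 c0 v0 l0 _ _ _ mf fv u0 hu) _.
- by move=> g mg; exact: potential_ge0.
- by move=> g mg; exact: potential_decrease.
- by move=> g mg gg gv; apply: (Vbad_good r0 r1 d0 L0 Bk0 K0 t0 Lt tK dB Ke mg gg v0 gv).
have lk0 : 0 < l%:R * (kappa rho L Bk * theta) by exact: mulr_gt0.
rewrite lerD2l ler_pM2r ?invr_gt0 //; exact: (potential_le r0 r1 L0 Bk0).
Qed.

Lemma Vbad_le f (E Lv rho rho' : R) :
    monotone f -> MaxInf R f = expR (- E) ->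
    M (fun=> 1 / 2) f * (1 - M (fun=> 1 / 2) f) = expR (- Lv) ->
    1 <= Lv -> 10 ^+ 6 * Lv <= E -> 10 ^+ 14 * Lv <= rho ^+ 2 * E ->
    0 < rho <= 1 -> rho / 2 <= rho' -> rho' <= 1 ->
  Vbad rho' (expR (rho * E / 10 ^+ 5)) f <= 1 / 5.
Proof.
move=> mf He Hv Lv1 LE LX /andP[r0 r1] rr' r1'.
have E1 : 10 ^+ 6 <= E by lra.
have E0 : 0 < E by lra.
have [X XE] : {X | X = rho * E} by exists (rho * E).
rewrite -XE; have XE1 : X <= E by rewrite XE ger_pMl.
have rX : 1 <= rho * X by rewrite XE mulrA -expr2; lra.
have X1 : 10 ^+ 14 * Lv <= X.
  by apply: le_trans LX _; rewrite XE expr2 -mulrA ger_pMl // mulr_gt0.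
have X0 : 0 < X by lra.
have X14 : 10 ^+ 14 <= X by lra.
have r'0 : 0 < rho' by lra.
have r'X : 1 / rho' <= 2 * X.
  rewrite ler_pdivrMr //; have : rho / 2 * X <= rho' * X by rewrite ler_pM2r.
  by lra.
have d0 := expR_gt0 (X / 10 ^+ 5); have d1 : 1 <= expR (X / 10 ^+ 5).
  by have := expR_ge1Dx (X / 10 ^+ 5); lra.
have [d dE] : {d | d = expR (X / 10 ^+ 5)} by exists (expR (X / 10 ^+ 5)).
rewrite -dE in d0 d1 *.
(* [K] is of order [E]: large enough for the gain [2^(- K rho')] to beat the powers of [d], small
   enough for [theta^-3] not to offset the maximal influence [exp(- E)]. *)
have [K [K0 KE K3]] : exists K : nat,
    [/\ (0 < K)%N, K%:R <= E / 10 ^+ 3 & E / (2 * 10 ^+ 3) <= K%:R].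
  exists (Num.truncn (E / 10 ^+ 3)).
  have /andP[K1 K2] : (Num.truncn (E / 10 ^+ 3))%:R <= E / 10 ^+ 3 <
      (Num.truncn (E / 10 ^+ 3)).+1%:R by apply: truncn_itv; lra.
  move: K1 K2; rewrite -[X in _ -> _ < X -> _]natr1 -(ltr0n R).
  by move: _%:R => u K1 K2; split; lra.
have KR : 0 < K%:R :> R by rewrite ltr0n.
have [Bk [Bk0 B2 B3]] : exists Bk : nat,
    [/\ (0 < Bk)%N, 2 * d <= Bk%:R & Bk%:R <= 3 * d].
  exists (Num.truncn (2 * d)).+1.
  have /andP[B1 B2] : (Num.truncn (2 * d))%:R <= 2 * d < (Num.truncn (2 * d)).+1%:R.
    by apply: truncn_itv; lra.
  split=> //; first exact: ltW.
  by rewrite -[X in X <= _]natr1; move: _%:R B1 {B2} => u B1; lra.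
have BR : 0 < Bk%:R :> R by rewrite ltr0n.
have B1' : 1 <= Bk%:R :> R by rewrite ler1n.
have [L [theta [L0 t0 th1 Lt [t5 t3]]]] := grid_parameters R K0.
have LR : 0 < L%:R :> R by rewrite ltr0n.
have kE : kappa rho' L Bk = rho' / (4 * L%:R * Bk%:R).
  by rewrite /kappa /ngrid natrM mulrA.
have kt : 2 * K%:R * kappa rho' L Bk = rho' * theta / (2 * Bk%:R).
  by rewrite kE -Lt; field; rewrite !gt_eqF.
have kt1 : 2 * K%:R * kappa rho' L Bk <= theta.
  rewrite kt ler_pdivrMr ?mulr_gt0 //.
  have : rho' * theta <= 1 * theta by rewrite ler_pM2r.
  have : theta * 1 <= theta * Bk%:R by rewrite ler_pM2l.
  lra.
have Kr : X / (4 * 10 ^+ 3) <= K%:R * rho'.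
  have h0 : 0 <= E / (2 * 10 ^+ 3) by lra.
  have h1 : 0 <= rho / 2 by lra.
  have := ler_pM h0 h1 K3 rr'; rewrite XE; lra.
have v0 : 0 < expR (- Lv) / 2 by rewrite divr_gt0 ?expR_gt0.
have kt1' : 0 <= 2 * K%:R * kappa rho' L Bk.
  by rewrite kt; apply: divr_ge0; apply: mulr_ge0 => //; exact: ltW.
have big : 100 <= (1 + 2 * K%:R * kappa rho' L Bk) ^+ ngrid L Bk * (expR (- Lv) / 2).
  apply: (@odds_bound R (K%:R * rho')); [|exact: Lv1| |by lra].
    by rewrite kt1' (le_trans kt1).
  by rewrite kE /ngrid natrM; field; rewrite !gt_eqF.
have small := test_bound X14 r'0 r'X dE B3 Kr.
(* [W] is 20 times [ngrid / (kappa * theta)], so [l >= W] queries bring the potential term down to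
   1/20. *)
have [W WE] : {W : R | W = 80 * L%:R ^+ 2 * Bk%:R ^+ 2 / (rho' * theta)} by eexists.
have L1 : 1 <= L%:R :> R by rewrite ler1n.
have W1 : 1 <= W.
  rewrite WE ler_pdivlMr ?mulr_gt0 // mul1r.
  have a1 : rho' * theta <= 1 by apply: mulr_ile1 => //; exact: ltW.
  have a2 : 1 <= L%:R ^+ 2 :> R by apply: exprn_ege1.
  have a3 : 1 <= Bk%:R ^+ 2 :> R by apply: exprn_ege1.
  have := ler_pM ler01 ler01 a2 a3; lra.
have [l [l0 l2 l3]] : exists l : nat, [/\ (0 < l)%N, W <= l%:R & l%:R <= 2 * W].
  exists (Num.truncn W).+1.
  have /andP[l1 l2] : (Num.truncn W)%:R <= W < (Num.truncn W).+1%:R.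
    by apply: truncn_itv; lra.
  split=> //; first exact: ltW.
  by rewrite -[X in X <= _]natr1; move: _%:R l1 {l2} => u l1; lra.
have lR : 0 < l%:R :> R by rewrite ltr0n.
(* Half the variance serves as [v]; then [2 v = m (1 - m)] is at most [m] and at most [1 - m]. *)
have Mb : 2 * (expR (- Lv) / 2) <= M (fun=> 1 / 2) f <= 1 - 2 * (expR (- Lv) / 2).
  rewrite -Hv; set m := M _ f.
  by have := sqr_ge0 m; have := sqr_ge0 (1 - m); move=> *; apply/andP; split; lra.
have u0 : 0 <= 4 * expR (- E) by rewrite mulr_ge0 ?expR_ge0.
have hu i : N (fun=> 1 / 2) f i <= 4 * expR (- E) by rewrite -He; exact: N_le_MaxInf.
have tK : 5 * theta <= (1 / 2) ^+ (64 * K) by rewrite t5.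
have Lt1 : 1 <= L%:R * theta by rewrite Lt ler1n.
apply: le_trans (Vbad_bound r'0 r1' d0 L0 Bk0 K0 l0 t0 Lt1 tK B2 kt1 big small v0 mf
  Mb u0 hu) _.
have t4 : (ngrid L Bk)%:R / (l%:R * (kappa rho' L Bk * theta)) <= 1 / 20.
  have -> : (ngrid L Bk)%:R / (l%:R * (kappa rho' L Bk * theta)) = W / 20 / l%:R.
    by rewrite kE /ngrid natrM WE; field; rewrite !gt_eqF.
  by rewrite ler_pdivrMr //; lra.
have t6 : l%:R * (4 * expR (- E)) / (2 * (expR (- Lv) / 2)) <= 1 / 20.
  have e3 : l%:R * (4 * expR (- E)) / (2 * (expR (- Lv) / 2)) =
      4 * l%:R * (expR (- E) * expR Lv).
    by rewrite (expRN Lv); field; rewrite gt_eqF ?expR_gt0.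
  rewrite e3; apply: (@le_trans _ _ (8 * W * (expR (- E) * expR Lv))).
    by apply: ler_wpM2r; [rewrite mulr_ge0 ?expR_ge0 | lra].
  apply: (@cost_bound R E X Lv d (1 / rho') theta W K Bk) => //.
  - by rewrite divr_ge0 // ltW.
  - by rewrite WE -Lt; field; rewrite !gt_eqF.
have := lerD t4 t6; lra.
Qed.

End Assembly.

Lemma survivors_bound (R : realType) (n : nat) (rho : R) : (0 < n)%N -> 0 < rho <= 1 ->
  [/\ (0 < `|Num.ceil (rho * n%:R)|)%N, (`|Num.ceil (rho * n%:R)| <= n)%N &
      rho * n%:R <= `|Num.ceil (rho * n%:R)|%N%:R].
Proof.
move=> n0 /andP[r0 r1]; have nR : 0 < n%:R :> R by rewrite ltr0n.
have rn0 : 0 < rho * n%:R by rewrite mulr_gt0.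
have c0 : 0 < Num.ceil (rho * n%:R) by rewrite ceil_gt0.
have cE : `|Num.ceil (rho * n%:R)|%N%:R = (Num.ceil (rho * n%:R))%:~R :> R.
  by rewrite natr_absz gtr0_norm.
split.
- by rewrite absz_gt0 gt_eqF.
- rewrite -(ler_nat R) cE.
  have : Num.ceil (rho * n%:R) <= n%:Z by rewrite ceil_le_int -pmulrn ger_pMl.
  by rewrite -(ler_int R) -pmulrn.
by rewrite cE ceil_ge.
Qed.

Theorem theorem4p5 (R : realType) :
  exists C c1 c2 : R,
    [/\ 1 < C, 0 < c1, 0 < c2 &
      forall (f : forall n : nat, cube 'I_n -> bool) (rho : nat -> R),
        (forall n, monotone (f n)) ->
        exists N : nat, forall n : nat, (N <= n)%N ->
          let r := log2 (Var R (f n)) / log2 (MaxInf R (f n)) in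
          0 < Var R (f n) ->
          C * log2 (1 / Var R (f n)) <= log2 (1 / MaxInf R (f n)) ->
          0 < rho n <= 1 ->
          c1 * Num.sqrt (r * log2 (1 / r)) <= rho n ->
          1 / 2 <= prob R (restrictions 'I_n `|Num.ceil (rho n * n%:R)|%N)
                     (fun Az => MaxInf R (f n) `^ (- (c2 * rho n))
                                <= (DT (restrict (f n) Az.1 Az.2))%:R)].
Proof.
(* [10^6] is the ratio of logarithms asked by [Vbad_le], the square of [10^7] is its constant
   [10^14], and [10^-5] is the factor in its depth exponent. *)
exists (10 ^+ 6), (10 ^+ 7), (1 / 10 ^+ 5); split; first by lra.
- by rewrite exprn_gt0.
- by rewrite divr_gt0 // exprn_gt0.
(* The bound holds for every [n], so the threshold is 0. *)
move=> f rho mf; exists 0%N => n _ r v0 hC rho01 hrho.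
have /andP[r0 r1] := rho01.
set v := Var R (f n) in r v0 hC hrho; set e := MaxInf R (f n) in r hC hrho *.
have l2 : 0 < ln 2 :> R by rewrite ln_gt0 // ltr1n.
have vM : v = _ := Var_M R (f n); set m := M _ (f n) in vM.
have v4 : v <= 1 / 4 by rewrite vM; have := sqr_ge0 (m - 1 / 2); lra.
have vexp : expR (- (- ln v)) = v by rewrite opprK lnK.
have e14 : 1 / 4 <= expR (- 1) :> R.
  have -> : - 1 = - (1 / 2) + - (1 / 2) :> R by field.
  have h := expR_ge1Dx (- (1 / 2) : R); have h0 : 0 <= 1 / 2 :> R by lra.
  have h1 : 1 / 2 <= expR (- (1 / 2)) :> R by lra.
  by rewrite expRD; have := ler_pM h0 h0 h1 h1; lra.
have Lv1 : 1 <= - ln v.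
  by rewrite -lerN2 opprK -ler_expR lnK //; apply: le_trans e14.
have hv : ln (1 / v) = - ln v by rewrite div1r lnV.
(* For [e = 0] the conventions [1 / 0 = 0] and [ln 0 = 0] make the right side of [hC] zero, while
   its left side is positive because [v <= 1/4]. *)
have e0 : 0 < e.
  rewrite lt_neqAle eq_sym; have -> : 0 <= e by exact: bigmax_ge_id.
  rewrite andbT; apply/eqP => ez; move: hC.
  rewrite /log2 ez hv div1r invr0 (ln0 (lexx 0)) mul0r mulrA ler_pdivrMr // mul0r.
  have : 1 <= 10 ^+ 6 :> R by lra.
  by move=> h; have := ler_pM ler01 ler01 h Lv1; lra.
have he : ln (1 / e) = - ln e by rewrite div1r lnV.
have LE : 10 ^+ 6 * (- ln v) <= - ln e.
  by move: hC; rewrite /log2 hv he mulrA ler_pM2r ?invr_gt0.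
have eexp : expR (- (- ln e)) = e by rewrite opprK lnK.
have E0 : 0 < - ln e by lra.
have rE : r = (- ln v) / (- ln e).
  rewrite /r /log2; field.
  by rewrite -[ln e]opprK oppr_eq0 !gt_eqF.
clearbody r.
have rp : 0 < r by rewrite rE divr_gt0 //; lra.
have r2 : r <= 1 / 2 by rewrite rE ler_pdivrMr //; lra.
have lr1 : 1 <= log2 (1 / r).
  rewrite /log2 ler_pdivlMr // [1 * ln 2]mul1r ler_ln ?posrE ?divr_gt0 //.
  by rewrite ler_pdivlMr //; lra.
(* Squaring the hypothesis on [rho n] and using [log2 (1 / r) >= 1] gives [10^14 r <= rho^2]; then
   multiply by [- ln e]. *)
have LX : 10 ^+ 14 * (- ln v) <= rho n ^+ 2 * - ln e.
  have h0 : 0 <= 10 ^+ 7 * Num.sqrt (r * log2 (1 / r)).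
    by rewrite mulr_ge0 ?sqrtr_ge0 // exprn_ge0.
  have : (10 ^+ 7 * Num.sqrt (r * log2 (1 / r))) ^+ 2 <= rho n ^+ 2.
    by rewrite lerXn2r ?nnegrE // ltW.
  have lr0 : 0 <= r * log2 (1 / r).
    by apply: mulr_ge0; [exact: ltW | exact: (le_trans ler01 lr1)].
  rewrite exprMn (sqr_sqrtr lr0) => h1.
  have h2 : r * 1 <= r * log2 (1 / r) by rewrite ler_pM2l.
  have h3 : 10 ^+ 14 * r <= rho n ^+ 2 by lra.
  have <- : r * - ln e = - ln v by rewrite rE divfK // gt_eqF.
  by rewrite mulrA ler_pM2r.
have n0 : (0 < n)%N.
  case: posnP => // nz; move: e0; rewrite /e /MaxInf big_pred0 ?ltxx // => i.
  by have := ltn_ord i; rewrite [X in (_ < X)%N]nz.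
have [k0 kn rk] := survivors_bound n0 rho01.
set k := `|_|%N in k0 kn rk *.
have nR : 0 < n%:R :> R by rewrite ltr0n.
have knT : (k <= #|'I_n|)%N by rewrite card_ord.
have := prob_DT_ge (e `^ (- (1 / 10 ^+ 5 * rho n))) (f n) k0 knT.
rewrite card_ord; apply: le_trans.
have dE : e `^ (- (1 / 10 ^+ 5 * rho n)) = expR (rho n * (- ln e) / 10 ^+ 5).
  by rewrite /powR gt_eqF //; congr expR; ring.
have kr1 : rho n / 2 <= k%:R / (2 * n%:R).
  by rewrite ler_pdivlMr ?mulr_gt0 //; lra.
have kr2 : k%:R / (2 * n%:R) <= 1 :> R.
  rewrite ler_pdivrMr ?mulr_gt0 // mul1r.
  have : k%:R <= n%:R :> R by rewrite ler_nat.
  lra.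
(* The bad probability is at most 1/5, which leaves at least [1 - 2/5]. *)
have := Vbad_le (mf n) (esym eexp) _ Lv1 LE LX rho01 kr1 kr2.
rewrite vexp -vM -dE => /(_ erefl); lra.
Qed.
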